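(* Let $0<\alpha\le1$, $\nu>0$, $\xi_0>0$, and for $\xi>0$ let $\Phi^{(n)}(t,\xi)$ be the state probabilities of the Prabhakar discrete-time process (PDTP) with parameters $\alpha,\nu,\xi$. Then for every $n\in\mathbb{N}_0$ and every $t>0$, as $h\to0$ with $t/h\in\mathbb{N}$, $$\lim_{h\to0}\Phi^{(n)}\!\left(\frac th,\xi_0h^{\alpha}\right)=(\xi_0t^{\alpha})^{n\nu}\left\{E^{n\nu}_{\alpha,\alpha n\nu+1}(-\xi_0t^{\alpha})-(\xi_0t^{\alpha})^{\nu}E^{(n+1)\nu}_{\alpha,\alpha(n+1)\nu+1}(-\xi_0t^{\alpha})\right\}.$$
   Context: $\mathbb{N}_0=\{0,1,2,\dots\}$. The PDTP with parameters $\alpha,\nu,\xi$ is the discrete-time renewal process with arrival times $J_0=0$, $J_n=\sum_{j=1}^nZ_j$, where the $Z_j$ are i.i.d. $\{1,2,\dots\}$-valued with generating function $\mathbb{E}u^{Z_j}=\frac{\xi^{\nu}u}{(\xi+(1-u)^{\alpha})^{\nu}}$, $|u|\le 1$ (principal branches). Its state probabilities are $\Phi^{(n)}(t,\xi)=\mathbb{P}(J_n\le t<J_{n+1})$ for $n,t\in\mathbb{N}_0$. The Prabhakar function is $E_{a,b}^c(z)=\sum_{m=0}^{\infty}\frac{(c)_m}{m!}\frac{z^m}{\Gamma(am+b)}$, with $(c)_0=1$, $(c)_m=c(c+1)\cdots(c+m-1)$. *)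

(* Defs.v *)
From HB Require Import structures.
From mathcomp Require Import all_boot all_order all_algebra finmap.
From mathcomp Require Import all_classical all_reals all_analysis.
From mathcomp Require Import complex.

Set Implicit Arguments.
Unset Strict Implicit.
Unset Printing Implicit Defensive.

Import Order.TTheory GRing.Theory Num.Theory.
Import numFieldNormedType.Exports.

Local Open Scope classical_set_scope.
Local Open Scope ring_scope.
Local Open Scope complex_scope.

(* Principal argument, in ]-pi, pi] (the value at 0 is irrelevant). *)
Definition carg (R : realType) (z : R[i]) : R :=
  let theta := acos (complex.Re z / ComplexField.Normc.normc z) in
  if 0 <= complex.Im z then theta else - theta.

(* Principal branch of z ^ a for a real exponent a; it is 0 if z = 0 and a is
   nonzero. *)
Definition cpowr (R : realType) (z : R[i]) (a : R) : R[i] :=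
  let r := ComplexField.Normc.normc z `^ a in
  (r * cos (a * carg z)) +i* (r * sin (a * carg z)).

(* Euler's integral: this is the Gamma function for a > 0 only. *)
Definition Gamma (R : realType) (a : R) : R :=
  \int[@lebesgue_measure R]_(x in `]0, +oo[) (x `^ (a - 1) * expR (- x)).

Definition pochhammer (R : realType) (c : R) (m : nat) : R :=
  \prod_(i < m) (c + i%:R).

(* The Prabhakar function at real arguments, for a, b > 0. *)
Definition prabhakar (R : realType) (a b c z : R) : R :=
  limn (series (fun m : nat =>
    pochhammer c m / m`!%:R * (z ^+ m / Gamma (a * m%:R + b)))).

Definition mutually_independent (d : measure_display) (T : measurableType d)
    (R : realType) (P : probability T R) (Z : nat -> {RV P >-> nat}) : Prop :=
  forall (I : {fset nat}) (B : nat -> set nat),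
    (forall i, i \in I -> measurable (B i)) ->
    fine (P (\bigcap_(i in [set` I]) Z i @^-1` B i)) =
    \prod_(i <- I) fine (P (Z i @^-1` B i)).

Definition identically_distributed (d : measure_display) (T : measurableType d)
    (R : realType) (P : probability T R) (Z : nat -> {RV P >-> nat}) : Prop :=
  forall (i j : nat) (B : set nat), measurable B ->
    distribution P (Z i) B = distribution P (Z j) B.

Definition cexpectation (d : measure_display) (T : measurableType d)
    (R : realType) (P : probability T R) (X : T -> R[i]) : R[i] :=
  fine 'E_P[fun w => complex.Re (X w)]%E +i* fine 'E_P[fun w => complex.Im (X w)]%E.

Definition pdtp_genfun (R : realType) (alpha nu xi : R) (u : R[i]) : R[i] :=
  (xi `^ nu)%:C * u / cpowr (xi%:C + cpowr (1 - u) alpha) nu.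

(* Z j is the (j+1)-st interarrival time. *)
Record is_PDTP (d : measure_display) (T : measurableType d) (R : realType)
    (P : probability T R) (alpha nu xi : R) (Z : nat -> {RV P >-> nat}) : Prop := {
  pdtp_indep : mutually_independent Z;
  pdtp_ident : identically_distributed Z;
  pdtp_pos : forall j w, (0 < Z j w)%N;
  pdtp_gf : forall j (u : R[i]), `|u| <= 1 ->
    cexpectation P (fun w => u ^+ Z j w) = pdtp_genfun alpha nu xi u
}.

Definition arrival (T : Type) (Z : nat -> T -> nat) (n : nat) (w : T) : nat :=
  (\sum_(j < n) Z j w)%N.

Definition state_prob (d : measure_display) (T : measurableType d)
    (R : realType) (P : probability T R) (Z : nat -> {RV P >-> nat})
    (n t : nat) : R :=
  fine (P [set w | (arrival Z n w <= t < arrival Z n.+1 w)%N]).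

(* Main.v *)
Require Import Defs.
From HB Require Import structures.
From mathcomp Require Import all_boot all_order all_algebra finmap.
From mathcomp Require Import all_classical all_reals all_analysis.
From mathcomp Require Import complex.
From mathcomp Require Import measurable_realfun ring lra.

Set Implicit Arguments.
Unset Strict Implicit.
Unset Printing Implicit Defensive.

Import Order.TTheory GRing.Theory Num.Theory.
Import numFieldNormedType.Exports.

Local Open Scope classical_set_scope.
Local Open Scope ring_scope.

(* Write c = n nu, v = (1 - u) ^ alpha, and let q_n(k) be the n-fold convolution
   of the step distribution, so that P(J_n = k) = q_n(k).  The generating
   function of q_n is
     xi ^ c u ^ n (xi + v) ^ (-c)
       = u ^ n sum_m (-1) ^ m (c)_m / m! xi ^ (c + m) (1 - u) ^ (-alpha (c + m))
   for u near 0 (where xi < v).  Expanding the powers of 1 - u, exchanging the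
   two sums and comparing coefficients gives, for xi < 1,
     P(J_n <= N + n)
       = sum_m (-1) ^ m (c)_m / m! xi ^ (c + m) (alpha (c + m) + 1)_N / N!.
   With xi = xi0 h ^ alpha and N + n = t / h, Gauss's limit
   (s + 1)_N / (N! N ^ s) -> 1 / Gamma (s + 1) makes this converge term by term
   to (xi0 t ^ alpha) ^ c times the Prabhakar series.  The series is dominated
   because (s + 1)_N / N! is the partial sum of the binomial series of
   (1 - u) ^ (-s) at u = 1, hence at most u ^ (-N) (1 - u) ^ (-s); take
   u = exp (-K h / t) with K large.  Finally P(J_n <= s < J_(n+1)) is a
   difference of two such distribution functions. *)

(** * The Gamma function *)

Section gamma.
Context {R : realType}.
Implicit Types (a s x y : R) (N : nat).
Local Notation mu := (@lebesgue_measure R).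

(** Write [x = (2 * a + 1) * y]; then [y <= expR y] and [a * y <= x / 2]. The [+ 1] keeps the scale
    positive at [a = 0]. *)
Lemma powR_le_expR a x : 0 <= a -> 0 <= x ->
  x `^ a <= (2 * a + 1) `^ a * expR (x / 2).
Proof.
move=> a0 x0; have c0 : 0 < 2 * a + 1 by lra.
have xE : x = (2 * a + 1) * (x / (2 * a + 1)) by rewrite mulrC divfK// gt_eqF.
have y0 : 0 <= x / (2 * a + 1) by rewrite divr_ge0// ltW.
rewrite {1}xE powRM ?(ltW c0)// ler_wpM2l ?powR_ge0//.
rewrite (@le_trans _ _ (expR (x / (2 * a + 1)) `^ a))//.
  apply: ge0_ler_powR; rewrite ?nnegrE ?expR_ge0//.
  by rewrite (le_trans _ (expR_ge1Dx _))// lerDr.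
rewrite -expRM ler_expR -mulrA ler_wpM2l//.
by rewrite mulrC ler_pdivrMr//; lra.
Qed.

(** The integrand of [Gamma (a + 1)]: with this shift, [0 <= a] rules out a singularity at 0. *)
Definition gamma_fun a x := x `^ a * expR (- x).

Lemma gamma_fun_ge0 a x : 0 <= gamma_fun a x.
Proof. by rewrite mulr_ge0 ?powR_ge0 ?expR_ge0. Qed.

Lemma measurable_gamma_fun a (D : set R) : measurable_fun D (gamma_fun a).
Proof.
apply: (@measurable_funS _ _ _ _ setT) => //.
apply: measurable_funM; first exact: measurable_powR.
by apply: measurableT_comp => //; exact: measurableT_comp.
Qed.

Lemma integrable_expR_scale (r : R) : 0 < r ->
  mu.-integrable `]0, +oo[ (EFin \o (fun x => expR (- r * x))).
Proof.
move=> r0.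
have : mu.-integrable `]0, +oo[ (EFin \o exponential_pdf r).
  exact: integrableS (integrable_exponential_pdf r0).
move=> /(@integrableZl _ _ _ mu _ (measurable_itv _) r^-1);
  apply: eq_integrable => //.
move=> x; rewrite inE/= in_itv/= andbT => x0.
by rewrite /= exponential_pdfE ?(ltW x0)// -EFinM mulrA mulVf ?mul1r// gt_eqF.
Qed.

(** By [powR_le_expR] the integrand is dominated by a multiple of [expR (- x / 2)]. *)
Lemma integrable_gamma_fun a : 0 <= a ->
  mu.-integrable `]0, +oo[ (EFin \o gamma_fun a).
Proof.
move=> a0.
have h0 : (0 : R) < 2^-1 by rewrite invr_gt0.
have /(@integrableZl _ _ _ mu _ (measurable_itv _) ((2 * a + 1) `^ a)) :=
  integrable_expR_scale h0.
apply: le_integrable => //.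
  by apply/measurable_EFinP; exact: measurable_gamma_fun.
move=> x /=; rewrite in_itv/= andbT => x0; rewrite lee_fin.
rewrite !ger0_norm ?gamma_fun_ge0 ?mulr_ge0 ?powR_ge0 ?expR_ge0//.
rewrite /gamma_fun (_ : - 2^-1 * x = x / 2 - x); last by field.
by rewrite expRD mulrA ler_wpM2r ?expR_ge0// powR_le_expR// ltW.
Qed.

Lemma is_derive_expR_scale (r x : R) :
  is_derive x (1 : R) (fun x => expR (r * x)) (r * expR (r * x)).
Proof.
have H : is_derive x (1 : R) ( *%R r) r.
  have := @is_deriveZ _ _ _ id r x 1 1 (is_derive_id _ _).
  by rewrite [r *: 1]mulr1.
by rewrite mulrC; exact: (@is_derive1_comp _ expR ( *%R r)).
Qed.

Lemma continuous_powR_gt0 a x : 0 < x -> {for x, continuous (@powR R ^~ a)}.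
Proof.
move=> x0; apply: differentiable_continuous; apply/derivable1_diffP.
by have [] := is_derive1_powR a x0.
Qed.

(** The case [a = 0] is separate: the power is then constantly 1, also at the point 0. *)
Lemma powR_cvg_right0 a : 0 <= a -> (x `^ a) @[x --> (0 : R)^'+] --> (0 : R) `^ a.
Proof.
rewrite le_eqVlt => /predU1P[<-|a0]; last by rewrite powR0 ?gt_eqF//;
  exact: powR_cvg0.
by under eq_fun do rewrite powRr0; rewrite powRr0; exact: cvg_cst.
Qed.

Lemma continuous_expR_scale (r : R) : continuous (fun x : R => expR (r * x)).
Proof.
move=> x; apply: differentiable_continuous; apply/derivable1_diffP.
by have [] := is_derive_expR_scale r x.
Qed.

Lemma continuous_gamma_fun a : 0 <= a ->
  {within `[0, +oo[, continuous (gamma_fun a)}.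
Proof.
move=> a0; apply/continuous_within_itvcyP.
have E : gamma_fun a = fun x => x `^ a * expR (- 1 * x).
  by apply/funext => x; rewrite mulN1r.
split=> [x|]; rewrite E.
  rewrite in_itv/= andbT => x0.
  have C := @continuous_powR_gt0 a x x0.
  exact: cvgM C (@continuous_expR_scale (- 1) x).
apply: cvgM; first exact: powR_cvg_right0.
by apply: cvg_at_right_filter; exact: continuous_expR_scale.
Qed.

Lemma Gamma_gamma_fun a : Gamma (a + 1) = \int[mu]_(x in `]0, +oo[) gamma_fun a x.
Proof. by rewrite /Gamma addrK. Qed.

Lemma cvgy_expR_scale (r : R) : 0 < r -> expR (- r * x) @[x --> +oo] --> (0 : R).
Proof.
move=> r0; rewrite (_ : (fun x => _) = (fun z => expR (- z)) \o (fun z => r * z)).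
  by apply: (@cvg_comp _ _ _ _ _ _ (pinfty_nbhs R));
    [exact: gt0_cvgMry|exact: cvgr_expR].
by apply/funext => x /=; rewrite mulNr.
Qed.

Lemma cvgy_gamma_fun a : 0 <= a -> gamma_fun a x @[x --> +oo] --> (0 : R).
Proof.
move=> a0; have h0 : (0 : R) < 2^-1 by rewrite invr_gt0.
have C0 : (2 * a + 1) `^ a * expR (- 2^-1 * x) @[x --> +oo] --> (0 : R).
  by rewrite -(mulr0 ((2 * a + 1) `^ a)); apply: cvgM;
    [exact: cvg_cst|exact: cvgy_expR_scale].
apply: squeeze_cvgr C0; last exact: cvg_cst.
near=> x; rewrite gamma_fun_ge0 /gamma_fun/=.
rewrite (_ : - 2^-1 * x = x / 2 - x); last by field.
by rewrite expRD mulrA ler_wpM2r ?expR_ge0// powR_le_expR.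
Unshelve. all: by end_near. Qed.

Lemma Rintegral_expR_scale (r : R) : 0 < r ->
  \int[mu]_(x in `]0, +oo[) expR (- r * x) = r^-1.
Proof.
move=> r0; rewrite Rintegral_itv_obnd_cbnd; last exact: integrable_expR_scale.
rewrite (@Rintegral_ge0_continuous_FTC2y _ _
  (fun x => - r^-1 * expR (- r * x)) _ 0).
- by rewrite mulr0 expR0 mulr1 sub0r opprK.
- by move=> x _; exact: expR_ge0.
- exact/continuous_subspaceT/continuous_expR_scale.
- by rewrite -(mulr0 (- r^-1)); apply: cvgM;
  [exact: cvg_cst|exact: cvgy_expR_scale].
- by move=> x _; have [] := @is_deriveZ _ _ _ _ (- r^-1) _ _ _
  (is_derive_expR_scale (- r) x).
- apply: cvg_at_right_filter; apply: cvgM; first exact: cvg_cst.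
  exact: continuous_expR_scale.
- move=> x _; rewrite derive1E.
  have [_ ->] := @is_deriveZ _ _ _ _ (- r^-1) _ _ _ (is_derive_expR_scale (- r) x).
  by rewrite /GRing.scale/= mulrA mulrNN mulVf ?mul1r// gt_eqF.
Qed.

Lemma Gamma1 : Gamma 1 = 1 :> R.
Proof.
rewrite -[X in Gamma X]add0r Gamma_gamma_fun -[RHS]invr1.
rewrite -(Rintegral_expR_scale ltr01).
by apply: eq_Rintegral => x _; rewrite /gamma_fun powRr0 mul1r mulN1r.
Qed.

Lemma is_deriveBZ (f g : R -> R) (c x df dg : R) :
  is_derive x (1 : R) f df -> is_derive x (1 : R) g dg ->
  is_derive x (1 : R) (fun y => - f y - c * g y) (- df - c * dg).
Proof.
move=> d1 d2.
exact: (is_deriveB (is_deriveN d1) (@is_deriveZ _ _ _ _ c _ _ _ d2)).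
Qed.

Lemma is_derive_mul (f g : R -> R) (x df dg : R) :
  is_derive x (1 : R) f df -> is_derive x (1 : R) g dg ->
  is_derive x (1 : R) (fun y => f y * g y) (f x * dg + g x * df).
Proof. by move=> d1 d2; exact: (is_deriveM d1 d2). Qed.

(* [x ^ a exp (- x) - a x ^ (a - 1) exp (- x)] has no constant sign, so a large
   multiple of [exp (- x / 2)] is added before applying the fundamental theorem
   for nonnegative functions. *)
Lemma GammaS a : 1 <= a -> Gamma (a + 1) = a * Gamma a.
Proof.
move=> a1; have a0 : 0 < a by apply: lt_le_trans a1.
have b0 : 0 <= a - 1 by rewrite subr_ge0.
have h0 : (0 : R) < 2^-1 by rewrite invr_gt0.
have -> : Gamma a = Gamma (a - 1 + 1) by rewrite subrK.
rewrite !Gamma_gamma_fun.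
(* By [powR_le_expR], [a * gamma_fun (a - 1) x <= D * e2 x], so [f] is nonnegative. Its
   antiderivative [F] runs from [- 2 * D] at 0 to 0 at infinity, and [2 * D] is also the integral of
   the added term, so the two cancel. *)
pose D := a * (2 * (a - 1) + 1) `^ (a - 1).
pose e2 x := expR (- 2^-1 * x).
have D0 : 0 <= D by rewrite mulr_ge0 ?powR_ge0// ltW.
pose f x := gamma_fun a x - a * gamma_fun (a - 1) x + D * e2 x.
pose F x := - gamma_fun a x - 2 * D * e2 x.
have f0 x : 0 <= x -> 0 <= f x.
  move=> x0; rewrite /f addrAC -addrA addr_ge0 ?gamma_fun_ge0// subr_ge0.
  rewrite /D -mulrA ler_wpM2l ?(ltW a0)// /gamma_fun /e2.
  rewrite (_ : - 2^-1 * x = - x + x / 2); last by field.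
  rewrite expRD [expR (- x) * _]mulrC mulrA ler_wpM2r ?expR_ge0//.
  exact: powR_le_expR.
have dF x : 0 < x -> is_derive x (1 : R) F (f x).
  move=> x0.
  have d1 := is_derive1_powR a x0.
  have d2 : is_derive x (1 : R) (fun x => expR (- x)) (- expR (- x)).
    rewrite (_ : (fun x => _) = (fun x => expR (- 1 * x))); last first.
      by apply/funext => y; rewrite mulN1r.
    by apply: is_derive_eq (is_derive_expR_scale (- 1) x) _; rewrite !mulN1r.
  have d3 : is_derive x (1 : R) e2 (- 2^-1 * e2 x).
    exact: is_derive_expR_scale.
  apply: is_derive_eq (is_deriveBZ (2 * D) (is_derive_mul d1 d2) d3) _.
  by rewrite /f /gamma_fun; field.
have ig := integrable_gamma_fun (ltW a0).
have ig1 : mu.-integrable `]0, +oo[ (EFin \o (fun x => a * gamma_fun (a - 1) x)).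
  exact: (@integrableZl _ _ _ mu _ (measurable_itv _) _ _
    (integrable_gamma_fun b0)).
have ie2 := integrable_expR_scale h0.
have iD : mu.-integrable `]0, +oo[ (EFin \o (fun x => D * e2 x)).
  exact: (@integrableZl _ _ _ mu _ (measurable_itv _) _ _ ie2).
have igB : mu.-integrable `]0, +oo[
    (EFin \o (fun x => gamma_fun a x - a * gamma_fun (a - 1) x)).
  exact: (@integrableB _ _ _ mu _ (measurable_itv _) _ _ ig ig1).
have : \int[mu]_(x in `]0, +oo[) f x = 2 * D.
  rewrite Rintegral_itv_obnd_cbnd; last exact: (@integrableD _ _ _ mu _
    (measurable_itv _) _ _ igB iD).
  rewrite (@Rintegral_ge0_continuous_FTC2y _ _ F _ 0)//.
  - by rewrite /F /gamma_fun /e2 powR0 ?gt_eqF// mulr0 expR0; ring.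
  - move=> x; apply: cvgD; first apply: cvgB.
    + exact: continuous_gamma_fun (ltW a0) x.
    + by apply: cvgM; [exact: cvg_cst|exact: continuous_gamma_fun b0 x].
    + apply: cvgM; first exact: cvg_cst.
      exact: (continuous_subspaceT (@continuous_expR_scale (- 2^-1))).
  - have -> : (0 : R) = - 0 - 2 * D * 0 by rewrite mulr0 oppr0 addr0.
    exact: cvgB (cvgN (cvgy_gamma_fun (ltW a0))) (cvgM (cvg_cst _)
      (cvgy_expR_scale h0)).
  - by move=> x x0; have [] := dF x x0.
  - apply: cvgB; last first.
      apply: cvgM; first exact: cvg_cst.
      by apply: cvg_at_right_filter; exact: continuous_expR_scale.
    apply: cvgN.
    by have /continuous_within_itvcyP[] := continuous_gamma_fun (ltW a0).
  - move=> x; rewrite in_itv/= andbT => x0; rewrite derive1E.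
    by have [] := dF x x0.
rewrite RintegralD// RintegralB// !RintegralZl ?integrable_gamma_fun//.
by rewrite Rintegral_expR_scale// invrK; lra.
Qed.

End gamma.

(** * Bounds on ratios of Gamma values and Gauss's limit *)

Section gamma_ratio.
Context {R : realType}.
Implicit Types (a b s x y : R) (N : nat).
Local Notation mu := (@lebesgue_measure R).

Lemma Gamma_nat N : Gamma (N%:R + 1) = N`!%:R :> R.
Proof.
elim: N => [|N IH]; first by rewrite add0r Gamma1 fact0.
by rewrite GammaS ?ler1n// factS natrM -IH natr1.
Qed.

Lemma pochhammerS a N : pochhammer a N.+1 = pochhammer a N * (a + N%:R).
Proof. by rewrite /pochhammer big_ord_recr. Qed.

Lemma pochhammer0 a : pochhammer a 0 = 1.
Proof. by rewrite /pochhammer big_ord0. Qed.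

Lemma Gamma_pochhammer s N : 0 <= s ->
  Gamma (N%:R + s + 1) = pochhammer (s + 1) N * Gamma (s + 1).
Proof.
move=> s0; elim: N => [|N IH]; first by rewrite add0r pochhammer0 mul1r.
rewrite (@GammaS _ (N.+1%:R + s)); last by rewrite -natr1 addrAC lerDr addr_ge0.
have E : N.+1%:R + s = N%:R + s + 1 by rewrite -natr1 addrAC.
by rewrite E IH pochhammerS; ring.
Qed.

(** As a function of [1 / x], the power of [x] is convex, and the left side is its tangent at
    [1 / b]. The bound follows from [1 + z <= expR z] at [z = s * ln (x / b)] and from
    [ln (b / x) <= b / x - 1]. *)
Lemma powR_ge_tangent x b s : 0 < x -> 0 < b -> 0 <= s ->
  b `^ s * (1 + s - s * b / x) <= x `^ s.
Proof.
move=> x0 b0 s0.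
have xE : x = b * (x / b) by rewrite mulrC divfK// gt_eqF.
have y0 : 0 < x / b by rewrite divr_gt0.
rewrite [in leRHS]xE powRM ?(ltW b0) ?(ltW y0)// ler_wpM2l ?powR_ge0//.
rewrite [in leRHS]/powR gt_eqF// (le_trans _ (expR_ge1Dx _))//.
rewrite -addrA lerD2l -mulrA -[X in X - _]mulr1 -mulrBr ler_wpM2l//.
have := @le_ln1Dx R (b / x - 1).
rewrite ltrBrDr addNr divr_gt0// => /(_ isT).
rewrite addrC subrK -invf_div lnV ?posrE// => H.
by rewrite -lerN2 opprB.
Qed.

Lemma powRV x s : 0 <= x -> x^-1 `^ s = x `^ (- s).
Proof. by move=> x0; rewrite -powR_inv1// -powRrM mulN1r. Qed.

(** The previous bound at the inverses of [x] and [b]: this is the tangent at [b] of a negative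
    power of [x]. *)
Lemma powRN_ge_tangent x b s : 0 < x -> 0 < b -> 0 <= s ->
  b `^ (- s) * (1 + s - s * x / b) <= x `^ (- s).
Proof.
move=> x0 b0 s0.
have := @powR_ge_tangent x^-1 b^-1 s.
rewrite !invr_gt0 invrK => /(_ x0 b0 s0).
by rewrite !powRV ?(ltW x0) ?(ltW b0)// -!mulrA [b^-1 * x]mulrC.
Qed.

(** Integrating a pointwise bound carries the tangent inequalities over to [Gamma]. *)
Lemma le_Gamma_lincomb (c1 c2 a1 a2 a : R) : 0 <= a1 -> 0 <= a2 -> 0 <= a ->
  (forall x, 0 < x -> c1 * gamma_fun a1 x - c2 * gamma_fun a2 x <= gamma_fun a x) ->
  c1 * Gamma (a1 + 1) - c2 * Gamma (a2 + 1) <= Gamma (a + 1).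
Proof.
move=> a10 a20 a0 H; rewrite !Gamma_gamma_fun.
have i1 := @integrableZl _ _ _ mu _ (measurable_itv _) c1 _
  (integrable_gamma_fun a10).
have i2 := @integrableZl _ _ _ mu _ (measurable_itv _) c2 _
  (integrable_gamma_fun a20).
rewrite -!RintegralZl ?integrable_gamma_fun// -RintegralB//.
apply: le_Rintegral => //.
- exact: (@integrableB _ _ _ mu _ (measurable_itv _) _ _ i1 i2).
- exact: integrable_gamma_fun.
- by move=> x /=; rewrite in_itv/= andbT => x0; exact: H.
Qed.

(* The base points of the tangents, [a] here and [a + s + 1] in the upper bound,
   make the linear corrections cancel after integration, by [GammaS]. *)
Lemma Gamma_ge_powR a s : 1 <= a -> 0 <= s ->
  a `^ s * Gamma (a + 1) <= Gamma (a + s + 1).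
Proof.
move=> a1 s0; have a0 : 0 < a by apply: lt_le_trans a1.
have b0 : 0 <= a - 1 by rewrite subr_ge0.
suff /le_trans : a `^ s * Gamma (a + 1) <=
    a `^ s * (1 + s) * Gamma (a + 1) - a `^ s * (s * a) * Gamma (a - 1 + 1).
  apply; apply: le_Gamma_lincomb => //; rewrite ?addr_ge0 ?(ltW a0)// => x x0.
  rewrite /gamma_fun !mulrA -mulrBl ler_wpM2r ?expR_ge0//.
  rewrite (@powRD _ x a s); last by rewrite (gt_eqF x0)/= implybT.
  have := powR_ge_tangent x0 a0 s0.
  move=> /(ler_wpM2l (powR_ge0 x a)); apply: le_trans.
  rewrite (@powRB _ x a 1) ?powRr1 ?(ltW x0)//;
    last by rewrite (gt_eqF x0)/= implybT.
  by rewrite le_eqVlt; apply/orP; left; apply/eqP; ring.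
rewrite subrK GammaS// le_eqVlt; apply/orP; left; apply/eqP; ring.
Qed.

Lemma Gamma_le_powR a s : 0 <= a -> 0 <= s ->
  Gamma (a + s + 1) <= (a + s + 1) `^ s * Gamma (a + 1).
Proof.
Proof.
move=> a0 s0; have b0 : 0 < a + s + 1 by lra.
(* With the power moved to the left, [gamma_fun a x] is [gamma_fun (a + s) x] times the power [- s]
   of [x], which the tangent at [a + s + 1] bounds from below. *)
rewrite -ler_pdivrMl ?powR_gt0// -powRN.
suff /le_trans : (a + s + 1) `^ (- s) * Gamma (a + s + 1) <=
    (a + s + 1) `^ (- s) * (1 + s) * Gamma (a + s + 1) -
    (a + s + 1) `^ (- s) * (s / (a + s + 1)) * Gamma (a + s + 1 + 1).
  apply; apply: le_Gamma_lincomb => [||//|x x0]; try by rewrite ?addr_ge0.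
  rewrite /gamma_fun !mulrA -mulrBl ler_wpM2r ?expR_ge0//.
  have := powRN_ge_tangent x0 b0 s0.
  move=> /(ler_wpM2l (powR_ge0 x (a + s))).
  rewrite -powRD; last by rewrite (gt_eqF x0)/= implybT.
  rewrite addrK; apply: le_trans.
  rewrite (@powRD _ x (a + s)) ?powRr1 ?(ltW x0)//;
    last by rewrite (gt_eqF x0)/= implybT.
  by rewrite le_eqVlt; apply/orP; left; apply/eqP; ring.
rewrite (@GammaS _ (a + s + 1)); last lra.
rewrite le_eqVlt; apply/orP; left; apply/eqP; field.
by rewrite gt_eqF.
Qed.

(** The lower bound at [a = 1] reads [1 <= Gamma (s + 2) = (s + 1) * Gamma (s + 1)]. *)
Lemma Gamma_gt0 s : 0 <= s -> 0 < Gamma (s + 1).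
Proof.
move=> s0; have := @Gamma_ge_powR 1 s (lexx _) s0.
have s1 : 1 <= s + 1 by rewrite lerDr.
rewrite powR1 mul1r (GammaS (lexx 1)) Gamma1 mulr1 [1 + s]addrC (GammaS s1).
by move=> /(lt_le_trans ltr01); rewrite pmulr_rgt0// ltr_wpDl.
Qed.

Lemma cvg_ratio1 a :
  (fun N => (N.+1%:R + a) / N.+1%:R) @ \oo --> (1 : R).
Proof.
have -> : (fun N => (N.+1%:R + a) / N.+1%:R) = (fun N => 1 + a * harmonic N).
  by apply/funext => N /=; rewrite mulrDl divff// pnatr_eq0.
rewrite -[X in _ --> X]addr0 -[X in _ --> _ + X](mulr0 a); apply: cvgD;
  first exact: cvg_cst.
by apply: cvgM; [exact: cvg_cst|exact: cvg_harmonic].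
Qed.

(** The quotient is [Gamma (N + s + 1) / Gamma (N + 1)], divided by the power [s] of [N] and by
    [Gamma (s + 1)]. The two bounds above squeeze it; the shift to [N.+1] provides their hypothesis
    [1 <= a]. *)
Lemma pochhammer_Gamma_cvg s : 0 <= s ->
  pochhammer (s + 1) N / N`!%:R / N%:R `^ s @[N --> \oo] --> (Gamma (s + 1))^-1.
Proof.
move=> s0; have G0 := Gamma_gt0 s0.
have Eq N : pochhammer (s + 1) N = Gamma (N%:R + s + 1) / Gamma (s + 1).
  by rewrite Gamma_pochhammer// mulfK// gt_eqF.
rewrite -cvg_shiftS.
apply: (@squeeze_cvgr _ _ _ _ (fun=> (Gamma (s + 1))^-1)
   (fun N => ((N.+1%:R + (s + 1)) / N.+1%:R) `^ s / Gamma (s + 1))).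
- apply: nearW => N; rewrite /= Eq.
  have N0 : 0 < N.+1%:R `^ s :> R by rewrite powR_gt0.
  have F0 : 0 < N.+1`!%:R :> R by rewrite ltr0n fact_gt0.
  rewrite [Gamma (_ + s + 1) / _ / _]mulrAC [_ / Gamma (s + 1) / _]mulrAC.
  rewrite -[X in X <= _]mul1r !ler_pM2r ?invr_gt0//.
  rewrite ler_pdivlMr// ler_pdivlMr// mul1r ler_pdivrMr// ler_pdivrMr//.
  rewrite powRM ?invr_ge0 ?addr_ge0//.
  rewrite -[_^-1 in X in _ && X]powR_inv1// -powRrM mulN1r powRN divfK ?gt_eqF//.
  rewrite -!Gamma_nat Gamma_ge_powR ?ler1n// addrA.
  exact: Gamma_le_powR.
- exact: cvg_cst.
- rewrite -[X in _ --> X]mul1r; apply: cvgM; last exact: cvg_cst.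
  have P1 : (1 : R) `^ s = 1 by rewrite powR1.
  rewrite -[X in _ --> X]P1.
  exact: (cvg_comp _ _ (@cvg_ratio1 (s + 1)) (@continuous_powR_gt0 R s 1 ltr01)).
Qed.
End gamma_ratio.

(** * Real series *)

Section real_series.
Context {R : realType}.
Implicit Types (f g a b : nat -> R) (l A B : R).

(** Passage to extended reals, where sums of nonnegative double series can be exchanged;
    [nneseries_fin_cvg] is the way back. *)
Lemma nneseries_EFin f l : series f @ \oo --> l ->
  (\sum_(k <oo) (f k)%:E = l%:E)%E.
Proof.
move=> fl; apply: cvg_lim => //.
under eq_fun do rewrite sumEFin.
exact: (cvg_comp _ _ fl).
Qed.

Lemma nneseries_fin_cvg f l : (forall k, 0 <= f k) ->
  (\sum_(k <oo) (f k)%:E = l%:E)%E -> series f @ \oo --> l.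
Proof.
move=> f0 fl; have cf : cvgn (series f) by apply: nnseries_is_cvg;
  rewrite ?fl ?ltry.
by have := nneseries_EFin cf; rewrite fl => -[->].
Qed.

(** Tonelli for series. Each column sum is one term of the finite total, hence finite itself, so the
    exchanged sums are real limits. *)
Lemma nnseries_interchange (a : nat -> nat -> R) (A : nat -> R) (S : R) :
  (forall i k, 0 <= a i k) -> (forall i, series (a i) @ \oo --> A i) ->
  series A @ \oo --> S ->
  exists2 B : nat -> R, (forall k, series (a ^~ k) @ \oo --> B k) &
    series B @ \oo --> S.
Proof.
move=> a0 aA AS.
have tot : (\sum_(k <oo) \sum_(i <oo) (a i k)%:E = S%:E)%E.
  rewrite -nneseries_interchange; last by move=> *; rewrite lee_fin.
  rewrite -(nneseries_EFin AS); apply: eq_eseriesr => i _.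
  exact: nneseries_EFin.
have B0 k : (0 <= \sum_(i <oo) (a i k)%:E)%E.
  by apply: nneseries_ge0 => i _ _; rewrite lee_fin.
have Bfin k : (\sum_(i <oo) (a i k)%:E)%E \is a fin_num.
  rewrite ge0_fin_numE// (le_lt_trans _ (ltry S))// -tot.
  rewrite (@nneseriesD1 _ (fun k => \sum_(i <oo) (a i k)%:E)%E k)//.
  by rewrite leeDl// nneseries_ge0.
exists (fun k => fine (\sum_(i <oo) (a i k)%:E)%E).
  by move=> k; apply: nneseries_fin_cvg; rewrite ?fineK.
apply: nneseries_fin_cvg => [k|]; first exact: fine_ge0.
by rewrite -tot; apply: eq_eseriesr => k _; rewrite fineK.
Qed.

Lemma eq_cvg_series f g l : f =1 g -> series f @ \oo --> l -> series g @ \oo --> l.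
Proof. by move=> /funext ->. Qed.

Lemma cvg_series_sub f g l A : series f @ \oo --> l -> series g @ \oo --> A ->
  series (fun k => f k - g k) @ \oo --> l - A.
Proof.
move=> fl gA; rewrite (_ : series _ = series f - series g); first exact: cvgB.
by apply/funext => n; rewrite /series/= sumrB.
Qed.

Lemma cvg_series_add f g l A : series f @ \oo --> l -> series g @ \oo --> A ->
  series (fun k => f k + g k) @ \oo --> l + A.
Proof.
move=> fl gA; rewrite (_ : series _ = series f + series g); first exact: cvgD.
by apply/funext => n; rewrite /series/= big_split.
Qed.

Lemma cvg_series_scale c f l : series f @ \oo --> l ->
  series (fun k => c * f k) @ \oo --> c * l.
Proof.
move=> fl; rewrite (_ : series _ = (fun n => c * series f n)).
  by apply: cvgM => //; exact: cvg_cst.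
by apply/funext => n; rewrite /series/= mulr_sumr.
Qed.

(** Fubini from Tonelli: both [a i k + |a i k|] and [|a i k|] are nonnegative, and their exchanged
    sums are subtracted. *)
Lemma series_interchange (a : nat -> nat -> R) (A C : nat -> R) (S T : R) :
  (forall i, series (fun k => `|a i k|) @ \oo --> A i) -> series A @ \oo --> S ->
  (forall i, series (a i) @ \oo --> C i) -> series C @ \oo --> T ->
  exists2 B : nat -> R, (forall k, series (a ^~ k) @ \oo --> B k) &
    series B @ \oo --> T.
Proof.
move=> aA AS aC CT.
have [B1 aB1 B1S] := nnseries_interchange (fun i k => normr_ge0 (a i k)) aA AS.
have p0 i k : 0 <= a i k + `|a i k| by rewrite addrC -[X in _ + X]opprK
  subr_ge0 -normrN ler_norm.
have [B2 aB2 B2S] := nnseries_interchange p0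
  (fun i => cvg_series_add (aC i) (aA i)) (cvg_series_add CT AS).
exists (fun k => B2 k - B1 k).
  move=> k; have := cvg_series_sub (aB2 k) (aB1 k).
  by under [X in series X]eq_fun do rewrite addrK.
by have := cvg_series_sub B2S B1S; rewrite addrK.
Qed.

Lemma series_shift f i n :
  series (fun k => if (i <= k)%N then f (k - i)%N else 0) (n + i)%N = series f n.
Proof.
rewrite /series/= addnC (@big_cat_nat _ _ _ i)//= ?leq_addr//.
rewrite big_nat big1 ?add0r; last by move=> k /andP[_ ki]; rewrite leqNgt ki.
rewrite -{1}(add0n i) big_addn addKn !big_mkord.
by apply: eq_bigr => k _; rewrite leq_addl addnK.
Qed.

Lemma cvg_series_shift f i l : series f @ \oo --> l ->
  series (fun k => if (i <= k)%N then f (k - i)%N else 0) @ \oo --> l.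
Proof.
by move=> fl; rewrite -(cvg_shiftn i); under eq_fun do rewrite series_shift.
Qed.

Lemma cvg_series_finite f N : (forall k, (N <= k)%N -> f k = 0) ->
  series f @ \oo --> \sum_(k < N) f k.
Proof.
move=> f0; apply: cvg_near_cst; exists N => // n /= Nn.
rewrite /series/= (@big_cat_nat _ _ _ N)//= [X in _ + X]big_nat [X in _ +
  X]big1 ?addr0 ?big_mkord//.
by move=> k /andP[/f0].
Qed.

(** Tonelli for the array whose row [i] is [a i] times [b] shifted by [i]: the rows sum to
    [a i * B], and each column is a finite convolution sum. *)
Lemma cauchy_product a b A B : (forall k, 0 <= a k) -> (forall k, 0 <= b k) ->
  series a @ \oo --> A -> series b @ \oo --> B ->
  series (fun k => \sum_(i < k.+1) a i * b (k - i)%N) @ \oo --> A * B.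
Proof.
move=> a0 b0 aA bB.
pose d i k := a i * (if (i <= k)%N then b (k - i)%N else 0).
have d0 i k : 0 <= d i k by rewrite mulr_ge0//; case: ifP.
have dB i : series (d i) @ \oo --> a i * B by
  apply/cvg_series_scale/cvg_series_shift.
have [|E dE Et] := @nnseries_interchange d _ (A * B) d0 dB.
  rewrite mulrC; under [X in series X]eq_fun do rewrite mulrC.
  exact: cvg_series_scale.
rewrite (_ : (fun k => _) = E)//; apply/funext => k.
have dk : series (d ^~ k) @ \oo --> \sum_(i < k.+1) d i k.
  by apply: cvg_series_finite => i ki; rewrite /d leqNgt ki mulr0.
rewrite -(cvg_lim _ (dE k))// (cvg_lim _ dk)//.
by apply: eq_bigr => i _; rewrite /d -ltnS ltn_ord.
Qed.

(** Dominated convergence for series: the tail of [g] bounds the tails of [L] and of every late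
    [f M] at once, and a finite partial sum converges term by term. *)
Lemma tannery (f : nat -> nat -> R) (F L g : nat -> R) :
  cvgn (series g) ->
  (\forall M \near \oo, forall m, `|f M m| <= g m) ->
  (forall m, f M m @[M --> \oo] --> L m) ->
  (\forall M \near \oo, series (f M) @ \oo --> F M) ->
  cvgn (series L) /\ F @ \oo --> limn (series L).
Proof.
move=> cg fg fL fF.
have Lg m : `|L m| <= g m.
  apply: (ler_cvg_to (cvg_norm (fL m)) (cvg_cst (g m))).
  by apply: filterS fg => M; exact.
have g0 m : 0 <= g m by apply: le_trans (Lg m).
have cL : cvgn (series L).
  apply: normed_cvg; apply: series_le_cvg cg => // m; exact: normr_ge0.
split=> //.
have tail (h : nat -> R) (l : R) n : (forall m, `|h m| <= g m) ->
    series h @ \oo --> l -> `|l - series h n| <= limn (series g) - series g n.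
  move=> hg hl.
  have c1 : `|series h k - series h n| @[k --> \oo] --> `|l - series h n|.
    by apply: cvg_norm; apply: cvgB => //; exact: cvg_cst.
  have c2 : (series g k - series g n) @[k --> \oo] --> limn (series g) - series g n.
    by apply: cvgB => //; exact: cvg_cst.
  apply: (ler_cvg_to c1 c2); exists n => // k /= nk.
  rewrite !sub_series_geq// (le_trans (ler_norm_sum _ _ _))//.
  exact: ler_sum.
apply/cvgrPdist_lt => e e0.
have e3 : 0 < e / 3 by rewrite divr_gt0.
have [n _ ng] : \forall n \near \oo, `|limn (series g) - series g n| < e / 3.
  by move: e3; move: (e / 3); apply/cvgrPdist_lt.
have {}ng := le_lt_trans (ler_norm _) (ng n (leqnn n)).
have fn : series (f M) n @[M --> \oo] --> series L n.
  elim: n {ng} => [|n IHn].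
    by rewrite /series/= big_geq//; under eq_fun do rewrite big_geq//;
      exact: cvg_cst.
  by rewrite seriesSr; under eq_fun do rewrite seriesSr; apply: cvgD.
near=> M.
have h1 : `|limn (series L) - series L n| < e / 3 by apply: le_lt_trans ng;
  exact: tail.
have h2 : `|F M - series (f M) n| < e / 3.
  by apply: le_lt_trans ng; apply: tail; near: M.
have h3 : `|series L n - series (f M) n| < e / 3.
  by near: M; move: e3; move: (e / 3); apply/cvgrPdist_lt.
rewrite (_ : _ - _ = (limn (series L) - series L n) + (series L n - series (f M) n)
  - (F M - series (f M) n)); last by rewrite !opprB; ring.
apply: (le_lt_trans (ler_normB _ _)).
rewrite (_ : e = e / 3 + e / 3 + e / 3); last by field.
rewrite ltrD// (le_lt_trans (ler_normD _ _))// ltrD//.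
Unshelve. all: by end_near. Qed.

(** The induction runs on the sharper bound with [- 2 * q ^+ n], which is preserved because
    [2 * q ^+ n.+1 <= q ^+ n]. *)
Lemma sum_geometric_le (q : R) m n : 0 <= q -> q <= 2^-1 -> (m <= n)%N ->
  \sum_(m <= k < n) q ^+ k <= 2 * q ^+ m.
Proof.
move=> q0 q2 mn; suff : \sum_(m <= k < n) q ^+ k <= 2 * q ^+ m - 2 * q ^+ n.
  by move/le_trans; apply; rewrite lerBlDr lerDl mulr_ge0 ?exprn_ge0.
elim: n mn => [|n IH]; first by rewrite leqn0 => /eqP ->; rewrite big_geq// subrr.
rewrite leq_eqVlt => /predU1P[->|]; first by rewrite big_geq// subrr.
rewrite ltnS => mn; have {}IH := IH mn.
rewrite big_nat_recr//= (le_trans (lerD IH (lexx _)))//.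
have : 2 * q ^+ n.+1 <= q ^+ n.
  by rewrite exprS mulrA ler_piMl ?exprn_ge0//; lra.
by lra.
Qed.

(** Strong induction on [N]. The terms are bounded at a fixed point [u0], so at [q * u0] the terms
    after [N] sum to at most a constant times [q ^+ N.+1]. As the lower coefficients vanish,
    dividing by [q ^+ N] bounds [f N] by a multiple of [q], for every small [q]. *)
Lemma power_series_eq0 (f : nat -> R) (e : R) : 0 < e ->
  (forall u, 0 < u < e -> series (fun k => f k * u ^+ k) @ \oo --> (0 : R)) ->
  forall N, f N = 0.
Proof.
move=> e0 f0 N; elim/ltn_ind: N => N IH.
pose u0 := e / 2.
have u00 : 0 < u0 by rewrite divr_gt0.
have u0e : u0 < e by rewrite /u0; lra.
have cs : cvgn (series (fun k => f k * u0 ^+ k)).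
  by apply/cvg_ex; exists 0; apply: f0; rewrite u00.
have [C [Cr HC]] := cvg_series_bounded cs.
have {HC} HC k : `|f k * u0 ^+ k| <= `|C| + 1.
  by apply: (HC (`|C| + 1)) => //; rewrite (le_lt_trans (ler_norm C))// ltrDl.
set D := `|C| + 1 in HC.
have D0 : 0 < D by rewrite ltr_wpDl.
have key q : 0 < q -> q <= 2^-1 -> `|f N| * u0 ^+ N <= 2 * D * q.
  move=> q0 q2; pose u := q * u0.
  have uu : 0 < u < e by rewrite mulr_gt0//= (le_lt_trans _ u0e)// ler_piMl
    ?(ltW u00)//; lra.
  suff : `|f N * u ^+ N| <= 0 + D * (2 * q ^+ N.+1).
    rewrite add0r normrM [ `|u ^+ N|]ger0_norm ?exprn_ge0//;
      last by case/andP: uu => /ltW.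
    rewrite /u exprMn exprS.
    rewrite (_ : `|f N| * (_ * _) = `|f N| * u0 ^+ N * q ^+ N); last by ring.
    rewrite (_ : D * (_ * _) = 2 * D * q * q ^+ N); last by ring.
    by rewrite ler_pM2r// exprn_gt0.
  have c1 : `|series (fun k => f k * u ^+ k) n| + D * (2 * q ^+ N.+1) @[n --> \oo]
      --> 0 + D * (2 * q ^+ N.+1).
    apply: cvgD; last exact: cvg_cst.
    by rewrite -(@normr0 _ R); apply: cvg_norm; exact: f0.
  apply: (ler_cvg_to (cvg_cst _) c1); exists N.+1 => // n /= Nn.
  rewrite /series/= (@big_cat_nat _ _ _ N.+1)//= big_nat_recr//= big_nat big1
    ?add0r; last first.
    by move=> k /andP[_ /IH ->]; rewrite mul0r.
  set T := \sum_(N.+1 <= k < n) _.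
  have TD : `|T| <= D * (2 * q ^+ N.+1).
    rewrite (le_trans (ler_norm_sum _ _ _))//.
    apply: (@le_trans _ _ (\sum_(N.+1 <= k < n) D * q ^+ k)).
      apply: ler_sum => k _; rewrite /u exprMn mulrCA mulrC normrM.
      by rewrite [ `|q ^+ k|]ger0_norm ?exprn_ge0 ?(ltW q0)// ler_wpM2r
        ?exprn_ge0 ?(ltW q0).
    by rewrite -mulr_sumr ler_wpM2l ?(ltW D0)// sum_geometric_le ?(ltW q0).
  rewrite (le_trans _ (lerD (lexx _) TD))//.
  by rewrite -{1}[f N * _](addrK T) (le_trans (ler_normB _ _)).
apply/eqP; rewrite -normr_eq0; apply/contraT => fN0.
have a0 : 0 < `|f N| * u0 ^+ N by rewrite mulr_gt0 ?exprn_gt0// lt_neqAle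
  eq_sym fN0 normr_ge0.
set a := `|f N| * u0 ^+ N in a0 key.
(* This choice gives [2 * D * q <= a / 2], against [a <= 2 * D * q] from [key]. *)
pose q := Num.min 2^-1 (a / (4 * D)).
have q0 : 0 < q by rewrite lt_min invr_gt0 ltr0n/= divr_gt0// mulr_gt0.
have /key : q <= 2^-1 by rewrite ge_min lexx.
move=> /(_ q0); rewrite leNgt => /negP; case.
have : q <= a / (4 * D) by rewrite ge_min lexx orbT.
rewrite ler_pdivlMr ?mulr_gt0//.
have : 0 < D * q by rewrite mulr_gt0.
by nra.
Qed.

Lemma power_series_inj (f g : nat -> R) (e : R) (h : R -> R) : 0 < e ->
  (forall u, 0 < u < e -> series (fun k => f k * u ^+ k) @ \oo --> h u) ->
  (forall u, 0 < u < e -> series (fun k => g k * u ^+ k) @ \oo --> h u) ->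
  f =1 g.
Proof.
move=> e0 fh gh N; apply/eqP; rewrite -subr_eq0; apply/eqP.
apply: (@power_series_eq0 (fun k => f k - g k) _ e0) => u ue.
have := cvg_series_sub (fh u ue) (gh u ue); rewrite subrr.
by under [X in series X]eq_fun do rewrite -mulrBl.
Qed.

End real_series.

Arguments cvg_series_scale {R} c {f l} _.
Arguments cvg_series_shift {R f} i {l} _.

(** * The binomial series *)

Section binomial_series.
Context {R : realType}.
Implicit Types (c s x u : R) (m N : nat).

Lemma natr_fact_neq0 m : m`!%:R != 0 :> R.
Proof. by rewrite pnatr_eq0 -lt0n fact_gt0. Qed.

(** The coefficient of [x ^+ m] in the power [- c] of [1 - x]. *)
Definition rbin c m := pochhammer c m / m`!%:R.

Lemma rbin0 c : rbin c 0 = 1.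
Proof. by rewrite /rbin pochhammer0 fact0 divr1. Qed.

Lemma rbinS c m : m.+1%:R * rbin c m.+1 = (c + m%:R) * rbin c m.
Proof.
rewrite /rbin pochhammerS factS natrM; field.
by rewrite natr_fact_neq0 nat1r pnatr_eq0.
Qed.

Lemma pochhammer_recl c m : pochhammer c m.+1 = c * pochhammer (c + 1) m.
Proof.
rewrite /pochhammer big_ord_recl addr0; congr (_ * _).
by apply: eq_bigr => i _; rewrite /bump/= natrD addrA.
Qed.

Lemma rbin_diffs c : pseries_diffs (rbin c) = (fun m => c * rbin (c + 1) m).
Proof.
apply/funext => m; rewrite /pseries_diffs /rbin pochhammer_recl factS natrM; field.
by rewrite natr_fact_neq0 nat1r pnatr_eq0.
Qed.

Lemma rbin_pascal c m : rbin (c + 1) m.+1 = rbin (c + 1) m + rbin c m.+1.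
Proof.
rewrite /rbin (pochhammer_recl c) pochhammerS factS natrM -natr1; field.
by rewrite natr_fact_neq0 natr1 pnatr_eq0.
Qed.

(** Summing coefficients amounts to one more factor [1 / (1 - x)], which raises [c] by one. *)
Lemma rbin_sum c N : \sum_(j < N.+1) rbin c j = rbin (c + 1) N.
Proof.
elim: N => [|N IH]; first by rewrite big_ord_recl big_ord0 addr0 !rbin0.
by rewrite big_ord_recr/= IH rbin_pascal.
Qed.

Lemma rbin_ge0 c m : 0 <= c -> 0 <= rbin c m.
Proof.
by move=> c0; rewrite divr_ge0// prodr_ge0// => i _; rewrite addr_ge0.
Qed.

Lemma ratio_test (f : nat -> R) (r : R) m0 : (forall m, 0 <= f m) -> 0 <= r < 1 ->
  (forall m, (m0 <= m)%N -> f m.+1 <= r * f m) -> cvgn (series f).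
Proof.
move=> f0 /andP[r0 r1] fr.
have bnd m : f (m + m0)%N <= f m0 * r ^+ m.
  elim: m => [|m IH]; first by rewrite mulr1.
  rewrite addSn (le_trans (fr _ _)) ?leq_addl// exprS mulrCA.
  by rewrite ler_wpM2l.
have : cvgn (series (fun m => f (m + m0)%N)).
  apply: (@series_le_cvg _ _ (geometric (f m0) r)) => //.
  - by move=> m; rewrite mulr_ge0 ?exprn_ge0.
  - by apply: is_cvg_geometric_series; rewrite ger0_norm.
move=> /cvg_ex[l hl]; apply/cvg_ex; exists (series f m0 + l).
rewrite -(cvg_shiftn m0).
rewrite (_ : (fun n => _) = (fun n => series f m0 + series (fun m => f (m +
  m0)%N) n)).
  by apply: cvgD => //; exact: cvg_cst.
apply/funext => n; rewrite /series/= (@big_cat_nat _ _ _ m0)//= ?leq_addl//.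
by congr (_ + _); rewrite -{1}(add0n m0) big_addn addnK.
Qed.

Lemma is_cvg_rbin c x : 0 <= c -> `|x| < 1 -> cvgn (pseries (rbin c) x).
Proof.
move=> c0 x1; apply: normed_cvg.
pose r := (`|x| + 1) / 2.
have rx : `|x| < r by rewrite /r; lra.
(* From [m0] on, [c <= (r - |x|) * (m + 1)], which makes the ratio [(c + m) * |x| / (m + 1)] of
   consecutive terms at most [r]. *)
pose m0 := Num.truncn (c / (r - `|x|)).
apply: (@ratio_test _ r m0) => [m||m mm] /=.
- exact: normr_ge0.
- by rewrite /r; have := normr_ge0 x; lra.
rewrite (normrM (rbin c m.+1)) (normrM (rbin c m)) !normrX.
rewrite !(ger0_norm (rbin_ge0 _ c0)) exprS mulrA [leRHS]mulrA ler_wpM2r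
  ?exprn_ge0//.
have m0p : 0 < m.+1%:R :> R by [].
rewrite -(ler_pM2l m0p) mulrA rbinS [leRHS]mulrCA.
have : c / (r - `|x|) < m.+1%:R.
  by apply: (lt_le_trans (truncnS_gt _)); rewrite ler_nat.
rewrite ltr_pdivrMr ?subr_gt0// -natr1 => H.
have := rbin_ge0 m c0; move: (rbin c m) => b b0.
rewrite mulrAC mulrA. rewrite ler_wpM2r//.

have := normr_ge0 x; have : (0 : R) <= m%:R by [].
by nra.
Qed.

Lemma pseriesZ (f : nat -> R) c x : pseries (fun m => c * f m) x = (fun n => c
  * pseries f x n).
Proof.
apply/funext => n; rewrite /pseries/series/= mulr_sumr.
by apply: eq_bigr => i _; rewrite mulrA.
Qed.

Lemma is_derive_rbin c x : 0 <= c -> `|x| < 1 ->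
  is_derive x (1 : R) (fun x => limn (pseries (rbin c) x))
    (c * limn (pseries (rbin (c + 1)) x)).
Proof.
(* Termwise differentiation at [x] asks for convergence of the series and its formal derivatives at
   a point [K] beyond [|x|]; the midpoint to 1 serves. *)
move=> c0 x1; pose K := (`|x| + 1) / 2.
have K0 : 0 <= K by rewrite /K; have := normr_ge0 x; lra.
have K1 : `|K| < 1 by rewrite ger0_norm// /K; lra.
have c10 : 0 <= c + 1 by lra.
have c20 : 0 <= c + 1 + 1 by lra.
have Z (a b y : R) : 0 <= b -> `|y| < 1 -> cvgn (pseries (fun m => a * rbin b m) y).
  move=> b0 y1; rewrite pseriesZ; apply: is_cvgM; first exact: is_cvg_cst.
  exact: is_cvg_rbin.
have D := @pseries_snd_diffs R (rbin c) K x.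
apply: is_derive_eq; first apply: D.
- exact: is_cvg_rbin.
- by rewrite rbin_diffs; exact: Z.
- have -> : pseries_diffs (pseries_diffs (rbin c)) = (fun m => c * (c + 1) *
  rbin (c + 1 + 1) m).
    apply/funext => m; rewrite rbin_diffs /pseries_diffs mulrCA.
    by have /funeqP/(_ m) := rbin_diffs (c + 1); rewrite /pseries_diffs => ->;
      rewrite mulrA.
  exact: Z.
- by rewrite [ltRHS]ger0_norm// /K; lra.
rewrite rbin_diffs pseriesZ; apply: cvg_lim => //.
by apply: cvgM; [exact: cvg_cst|exact: is_cvg_rbin].
Qed.

(** Coefficientwise this is [rbin_pascal]. Together with the derivative formula it is the
    differential equation solved by the power [- c] of [1 - x]. *)
Lemma rbin_ode c x : 0 <= c -> `|x| < 1 ->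
  (1 - x) * limn (pseries (rbin (c + 1)) x) = limn (pseries (rbin c) x).
Proof.
move=> c0 x1; have c10 : 0 <= c + 1 by lra.
have h1 := is_cvg_rbin c0 x1; have h2 := is_cvg_rbin c10 x1.
apply/esym/cvg_lim => //.
rewrite -(cvg_shiftS).
rewrite (_ : (fun n => _) = (fun n => pseries (rbin (c + 1)) x n.+1 - x *
  pseries (rbin (c + 1)) x n)).
  rewrite mulrBl mul1r; apply: cvgB; first by rewrite (cvg_shiftS (pseries _ x)).
  by apply: cvgM => //; exact: cvg_cst.
apply/funext => n; rewrite /pseries/series/= !big_nat_recl//= !rbin0.
rewrite -addrA; congr (_ + _); rewrite mulr_sumr -sumrB; apply: eq_bigr => i _.
by rewrite rbin_pascal exprS; ring.
Qed.

(** The sum of the series times the power [c] of [1 - y] has zero derivative on []-1, 1[] by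
    [rbin_ode], hence is constant there, and it equals 1 at 0. *)
Lemma binomial_series c x : 0 <= c -> `|x| < 1 ->
  series (fun m => rbin c m * x ^+ m) @ \oo --> (1 - x) `^ (- c).
Proof.
move=> c0 x1; have cx := is_cvg_rbin c0 x1.
suff E : limn (pseries (rbin c) x) * (1 - x) `^ c = 1.
  have P0 : (1 - x) `^ c != 0.
    by rewrite gt_eqF// powR_gt0//; move: x1; rewrite ltr_norml; lra.
  suff -> : (1 - x) `^ (- c) = limn (pseries (rbin c) x) by [].
  by apply: (mulIf P0); rewrite powRN mulVf// E.
pose h y := limn (pseries (rbin c) y) * (1 - y) `^ c.
have dh y : `|y| < 1 -> is_derive y (1 : R) h 0.
  move=> y1; have y0 : 0 < 1 - y by move: y1; rewrite ltr_norml; lra.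
  have d1 := is_derive_rbin c0 y1.
  have d0 : is_derive y (1 : R) (fun y => 1 - y) (-1).
    have := is_deriveB (is_derive_cst (1 : R) y (1 : R)) (is_derive_id y (1 : R)).
    by rewrite sub0r.
  have d2 := @is_derive1_comp R (@powR R ^~ c) (fun y => 1 - y) y _ _
     (is_derive1_powR c y0) d0.
  have d3 := is_derive_mul d1 d2.
  apply: is_derive_eq d3 _.
  rewrite /= -(rbin_ode c0 y1) powRB ?powRr1 ?(ltW y0)//; last first.
    by rewrite (gt_eqF y0)/= implybT.
  by field; rewrite gt_eqF.
have hE a b : `|a| < 1 -> `|b| < 1 -> a < b -> h a = h b.
  move=> a1 b1 ab.
  have yab y : y \in `[a, b] -> `|y| < 1.
    by move: a1 b1; rewrite in_itv/= !ltr_norml; lra.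
  have [|||z _] := @MVT_segment R h (fun=> 0) a b.
  - exact: ltW.
  - by move=> y /subset_itv_oo_cc /yab; exact: dh.
  - by apply: derivable_within_continuous => y /yab /dh [].
  by rewrite mul0r => /eqP; rewrite subr_eq0 => /eqP.
have h01 : h 0 = 1.
  rewrite /h subr0 powR1 mulr1; apply: cvg_lim => //; rewrite -cvg_shiftS.
  apply: cvg_near_cst; apply: nearW => n.
  rewrite /pseries/series/= big_nat_recl//= rbin0 mulr1 big1 ?addr0// => i _.
  by rewrite expr0n mulr0.
rewrite -/(h x) -h01.
have n0 : `|0 : R| < 1 by rewrite normr0.
by have [/hE->|/hE<-|->] := ltgtP x 0.
Qed.

(** By [rbin_sum] the left side is a sum of [rbin s i] over [i <= N], and [u ^+ N <= u ^+ i] for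
    these [i]. *)
Lemma rbin_le_powR s u N : 0 <= s -> 0 < u < 1 ->
  rbin (s + 1) N <= u ^- N * (1 - u) `^ (- s).
Proof.
move=> s0 /andP[u0 u1]; rewrite mulrC ler_pdivlMr ?exprn_gt0//.
have u1' : `|u| < 1 by rewrite ger0_norm// ltW.
apply: (ler_cvg_to (cvg_cst _) (binomial_series s0 u1')).
exists N.+1 => // n /= Nn.
rewrite /series/= (@big_cat_nat _ _ _ N.+1)//= -rbin_sum -[leLHS]addr0 lerD//;
  last first.
  by rewrite sumr_ge0// => i _; rewrite mulr_ge0 ?rbin_ge0 ?exprn_ge0 ?(ltW u0).
rewrite mulr_suml big_mkord; apply: ler_sum => i _; rewrite ler_wpM2l ?rbin_ge0//.
by rewrite ler_wiXn2l ?(ltW u0) ?(ltW u1)// -ltnS.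
Qed.

End binomial_series.

(** * Renewal processes *)

Fixpoint conv_pow (R : realType) (p : nat -> R) (n : nat) : nat -> R :=
  if n is n'.+1 then fun k => \sum_(i < k.+1) conv_pow p n' i * p (k - i)%N
  else fun k => (k == 0)%:R.

Section generating_function.
Context {R : realType}.
Variable p : nat -> R.
Hypothesis p0 : forall k, 0 <= p k.

Lemma conv_pow_ge0 n k : 0 <= conv_pow p n k.
Proof.
elim: n k => [|n IH] k /=; first by case: (k == 0).
by rewrite sumr_ge0// => i _; rewrite mulr_ge0.
Qed.

Lemma conv_pow_genfun n (u G : R) : 0 <= u ->
  series (fun k => p k * u ^+ k) @ \oo --> G ->
  series (fun k => conv_pow p n k * u ^+ k) @ \oo --> G ^+ n.
Proof.
move=> u0 pG; elim: n => [|n IH].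
  rewrite expr0 (_ : 1 = \sum_(k < 1) conv_pow p 0 k * u ^+ k).
    by apply: cvg_series_finite => -[|k]//= _; rewrite mul0r.
  by rewrite big_ord_recl big_ord0 /= expr0 mulr1 addr0.
have h1 k : 0 <= conv_pow p n k * u ^+ k by rewrite mulr_ge0 ?conv_pow_ge0
  ?exprn_ge0.
have h2 k : 0 <= p k * u ^+ k by rewrite mulr_ge0 ?exprn_ge0.
rewrite exprSr; apply: eq_cvg_series (cauchy_product h1 h2 IH pG) => k /=.
rewrite mulr_suml; apply: eq_bigr => i _.
by rewrite mulrACA -exprD subnKC// -ltnS.
Qed.

End generating_function.

Section renewal.
Context d (T : measurableType d) (R : realType) (P : probability T R).
Variable Z : nat -> {RV P >-> nat}.
Hypothesis indepZ : mutually_independent Z.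
Hypothesis identZ : identically_distributed Z.

Definition step_pmf k : R := fine (P (Z 0 @^-1` [set k])).

Lemma step_pmf_ge0 k : 0 <= step_pmf k.
Proof. by rewrite fine_ge0. Qed.

Lemma step_pmfE i k : fine (P (Z i @^-1` [set k])) = step_pmf k.
Proof.
by rewrite /step_pmf; congr fine; exact: (@identZ i 0%N [set k]).
Qed.

Lemma measurable_step i B : measurable (Z i @^-1` B).
Proof. exact: measurable_funPTI. Qed.

Lemma arrivalS n w : arrival Z n.+1 w = (arrival Z n w + Z n w)%N.
Proof. by rewrite /arrival big_ord_recr. Qed.

Lemma measurable_arrival n B : measurable (arrival Z n @^-1` B).
Proof.
elim: n B => [|n IH] B.
  rewrite (_ : _ @^-1` _ = [set _ | B 0%N]); last first.
    by apply/seteqP; split => w /=; rewrite /arrival big_ord0.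
  by case: (pselect (B 0%N)) => b; [rewrite (_ : mkset _ = setT)|rewrite (_ :
    mkset _ = set0)]
     => //; apply/seteqP; split.
rewrite (_ : _ @^-1` _ =
  \bigcup_i ((arrival Z n @^-1` [set i]) `&` (Z n @^-1` [set k | B (i + k)%N]))).
  by apply: bigcup_measurable => i _; apply: measurableI;
    [exact: IH|exact: measurable_step].
apply/seteqP; split => w /=; rewrite arrivalS.
  by move=> Bw; exists (arrival Z n w).
by move=> [i _ [/= <-]].
Qed.

(** The event that the [n]-th arrival is at [j] and the next steps are those listed in [l]. The list
    makes the induction on [n] go through without first proving that an arrival time is independent
    of later steps. *)
Definition arrival_event n j (l : seq nat) :=
  [set w | arrival Z n w = j /\ forall r, (r < size l)%N -> Z (n + r) w = nth
    0%N l r].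

Lemma arrival_eventE n j l : arrival_event n j l =
  (arrival Z n @^-1` [set j]) `&`
  \bigcap_(r in `I_(size l)) (Z (n + r) @^-1` [set nth 0%N l r]).
Proof. by []. Qed.

Lemma measurable_arrival_event n j l : measurable (arrival_event n j l).
Proof.
rewrite arrival_eventE; apply: measurableI; first exact: measurable_arrival.
by apply: bigcap_measurableType => r _; exact: measurable_step.
Qed.

(** Induction on [n] with [l] general: fixing the previous arrival [i] turns step [n] into a new
    head [j - i] of the list. At [n = 0] only a finite family of steps is left, and independence
    applies. *)
Lemma prob_arrival_event n j l :
  fine (P (arrival_event n j l)) =
  conv_pow step_pmf n j * \prod_(k <- l) step_pmf k.
Proof.
elim: n j l => [|n IH] j l /=.
  have [->|j0] := eqVneq j 0%N; last first.
    rewrite mul0r (_ : arrival_event _ _ _ = set0) ?measure0//.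
    apply/seteqP; split => w // [/=]; rewrite /arrival big_ord0 => h.
    by rewrite -h eqxx in j0.
  rewrite mul1r.
  pose I := [fset val i | i in 'I_(size l)]%fset.
  have := @indepZ I (fun i => [set nth 0%N l i]) (fun _ _ => Logic.I).
  rewrite (_ : \bigcap_(i in _) _ = arrival_event 0 0 l); last first.
    apply/seteqP; split => w /=.
      move=> H; split; first by rewrite /arrival big_ord0.
      by move=> r rl; rewrite add0n; apply: H; apply/imfsetP; exists (Ordinal rl).
    by move=> [_ H] r /= /imfsetP[/= i _ ->]; apply: H.
  move=> ->; rewrite big_imfset/=; last by move=> ? ? _ _; exact: val_inj.
  rewrite big_enum/= (big_nth 0%N) big_mkord.
  by apply: eq_bigr => i _; rewrite step_pmfE.
rewrite (_ : arrival_event _ _ _ =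
    \big[setU/set0]_(i < j.+1) arrival_event n i ((j - i)%N :: l)); last first.
  rewrite -(bigcup_mkord _ (fun i => arrival_event n i ((j - i)%N :: l))).
  apply/seteqP; split => w /=.
    rewrite /arrival_event/= arrivalS => -[aj H].
    exists (arrival Z n w); first by rewrite /= -aj ltnS leq_addr.
    split=> // -[_|r rl]; first by rewrite addn0 -aj addKn.
    by rewrite addnS -addSn; exact: H.
  move=> [i /= ij [ai H]]; rewrite /arrival_event/= arrivalS ai; split.
    by have := H 0%N isT; rewrite addn0 /= => ->; rewrite subnKC.
  by move=> r rl; rewrite addSn -addnS; exact: (H r.+1 rl).
rewrite measure_bigsetU_ord; last 2 first.
- by move=> i; exact: measurable_arrival_event.
- apply/trivIsetP => i k _ _ ik; apply/seteqP; split => // w [[ai _] [ak _]].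
  by case/eqP: ik; apply: val_inj; rewrite /= -ai -ak.
rewrite -sum_fine; last by move=> i _; rewrite fin_num_measure//;
  exact: measurable_arrival_event.
rewrite mulr_suml; apply: eq_bigr => i _.
by rewrite IH big_cons mulrA.
Qed.

Lemma prob_arrival n j :
  fine (P (arrival Z n @^-1` [set j])) = conv_pow step_pmf n j.
Proof.
have := prob_arrival_event n j [::]; rewrite big_nil mulr1 => <-.
by congr (fine (P _)); apply/seteqP; split => w //= [].
Qed.

Lemma prob_arrival_le n N :
  fine (P [set w | (arrival Z n w <= N)%N]) = \sum_(k < N.+1) conv_pow step_pmf n k.
Proof.
rewrite (_ : [set _ | _] = \big[setU/set0]_(k < N.+1) (arrival Z n @^-1` [set
  (k : nat)])).
  rewrite measure_bigsetU_ord; last 2 first.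
  - by move=> i; exact: measurable_arrival.
  - apply/trivIsetP => i k _ _ ik; apply/seteqP; split => // w [/= ai ak].
    by case/eqP: ik; apply: val_inj; rewrite /= -ai -ak.
  rewrite -sum_fine; last by move=> i _; rewrite fin_num_measure//;
    exact: measurable_arrival.
  by apply: eq_bigr => i _; exact: prob_arrival.
rewrite -(bigcup_mkord _ (fun k => arrival Z n @^-1` [set k])).
apply/seteqP; split => w /= [].
  by move=> h; exists (arrival Z n w).
by move=> k /= kN ->.
Qed.

(** Arrival times are nondecreasing in [n], so the subtracted event is contained in the other
    one. *)
Lemma state_probE n N : state_prob Z n N =
  fine (P [set w | (arrival Z n w <= N)%N]) -
  fine (P [set w | (arrival Z n.+1 w <= N)%N]).
Proof.
have m1 : measurable [set w | (arrival Z n.+1 w <= N)%N].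
  exact: (measurable_arrival n.+1 [set k | (k <= N)%N]).
have m2 : measurable [set w | (arrival Z n w <= N)%N].
  exact: (measurable_arrival n [set k | (k <= N)%N]).
have m3 : measurable [set w | (arrival Z n w <= N < arrival Z n.+1 w)%N].
  rewrite (_ : mkset _ = [set w | (arrival Z n w <= N)%N] `\` [set w | (arrival
    Z n.+1 w <= N)%N]).
    exact: measurableD.
  apply/seteqP; split => w /=; first by move=> /andP[-> ]; rewrite ltnNge => /negP.
  by move=> [-> /negP]; rewrite -ltnNge.
rewrite (_ : [set w | (arrival Z n w <= N)%N] =
  [set w | (arrival Z n w <= N < arrival Z n.+1 w)%N] `|` [set w | (arrival Z
    n.+1 w <= N)%N]).
  rewrite measureU//; last first.
    by apply/seteqP; split => // w /= [/andP[_]]; rewrite ltnNge => /negP.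
  by rewrite fineD ?fin_num_measure// addrK.
apply/seteqP; split => w /=.
  by move=> ->/=; case: ltnP => h; [left|right].
by case=> [/andP[]//|]; rewrite arrivalS; apply: leq_trans; exact: leq_addr.
Qed.

(** The integral is split over the level sets of [Z i]; it is finite because the integrand is at
    most 1. *)
Lemma expectation_genfun i (u : R) : 0 <= u <= 1 ->
  series (fun k => step_pmf k * u ^+ k) @ \oo --> fine 'E_P[fun w => u ^+ Z i w].
Proof.
move=> /andP[u0 u1].
have mf : measurable_fun setT (fun w => u ^+ Z i w).
  exact: (measurableT_comp (_ : measurable_fun setT (fun k : nat => u ^+ k))).
have E : ('E_P[(fun w => u ^+ Z i w)%R] = \sum_(k <oo) (step_pmf k * u ^+
  k)%R%:E)%E.
  rewrite unlock.
  have UT : \bigcup_k (Z i @^-1` [set k]) = [set: T].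
    by apply/seteqP; split => w // _; exists (Z i w).
  rewrite -{1}UT ge0_integral_bigcup//=.
  - apply: eq_eseriesr => k _.
    rewrite (eq_integral (cst (u ^+ k)%:E)); last by move=> w; rewrite inE /= => <-.
    rewrite integral_cst; last exact: measurable_step.
    by rewrite mulrC EFinM -(step_pmfE i) fineK// fin_num_measure//;
      exact: measurable_step.
  - by move=> k; exact: measurable_step.
  - by rewrite UT; exact/measurable_EFinP.
  - by move=> w _; rewrite lee_fin exprn_ge0.
  - apply/trivIsetP => k l _ _ kl; apply/seteqP; split => // w [/= Zk Zl].
    by case/eqP: kl; rewrite -Zk -Zl.
have p0 k : 0 <= step_pmf k * u ^+ k by rewrite mulr_ge0 ?step_pmf_ge0 ?exprn_ge0.
apply: nneseries_fin_cvg => //; rewrite -E fineK//.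
rewrite ge0_fin_numE; last by apply: expectation_ge0 => w; rewrite exprn_ge0.
apply: (@le_lt_trans _ _ ('E_P[cst (1 : R)%R])%E);
  last by rewrite expectation_cst ltry.
apply: expectation_le => //; first by move=> w; rewrite exprn_ge0.
by apply: aeW => w /=; rewrite exprn_ile1.
Qed.

End renewal.

(** * The PDTP generating function at real arguments *)

Section pdtp.
Context (R : realType).

(** On the positive axis the principal argument is [acos 1 = 0]. *)
Lemma cpowr_real (x a : R) : 0 < x -> cpowr x%:C%C a = (x `^ a)%:C%C.
Proof.
move=> x0; have nx : ComplexField.Normc.normc x%:C%C = x.
  by rewrite /ComplexField.Normc.normc/= expr0n/= addr0 sqrtr_sqr ger0_norm// ltW.
rewrite /cpowr /carg nx /= lexx divff ?gt_eqF// acos1 mulr0 cos0 sin0 mulr1 mulr0.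
by [].
Qed.

Context d (T : measurableType d) (P : probability T R).
Variables (Z : nat -> {RV P >-> nat}) (alpha nu xi : R).
Hypothesis pdtpZ : is_PDTP alpha nu xi Z.
Hypothesis xi0 : 0 < xi.

(** For real [u < 1] the bases of both complex powers are positive reals, so the formula becomes one
    for real powers. *)
Lemma pdtp_step_genfun (u : R) : 0 <= u < 1 ->
  series (fun k => step_pmf Z k * u ^+ k) @ \oo -->
  xi `^ nu * u / (xi + (1 - u) `^ alpha) `^ nu.
Proof.
move=> /andP[u0 u1].
have u01 : 0 <= u <= 1 by rewrite u0 ltW.
have := @expectation_genfun _ _ _ _ _ (pdtp_ident pdtpZ) 0%N _ u01.
suff -> : fine 'E_P[fun w => u ^+ Z 0%N w] =
   xi `^ nu * u / (xi + (1 - u) `^ alpha) `^ nu by [].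
have n1 : `|u%:C%C| <= 1.
  rewrite normc_def /= expr0n /= addr0 sqrtr_sqr ger0_norm//. by rewrite lecR ltW.
have := pdtp_gf pdtpZ 0%N n1.
rewrite /pdtp_genfun -(rmorph1 (real_complex R)) -rmorphB/=.
rewrite (@cpowr_real (1 - u)) ?subr_gt0//. rewrite -rmorphD cpowr_real;
  last by rewrite addr_gt0// powR_gt0// subr_gt0.
rewrite -fmorphV -!rmorphM/= /cexpectation => -[<- _].
congr (fine _); congr ('E_P[_])%E; apply/funext => w.
by rewrite -rmorphXn.
Qed.
End pdtp.

(** * Distribution function of the arrival times *)

Section expansion.
Context {R : realType}.

Lemma cvg_series_fsum (f : nat -> nat -> R) (l : nat -> R) N :
  (forall k, series (f k) @ \oo --> l k) ->
  series (fun m => \sum_(k < N) f k m) @ \oo --> \sum_(k < N) l k.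
Proof.
move=> fl; elim: N => [|N IH].
  rewrite big_ord0; apply: cvg_near_cst; apply: nearW => n.
  by rewrite /series/= big1// => i _; rewrite big_ord0.
rewrite big_ord_recr/=.
by apply: eq_cvg_series (cvg_series_add IH (fl N)) => m; rewrite big_ord_recr.
Qed.

(** The coefficient of the power [- (c + m)] of [v] in the expansion of [(xi / (xi + v)) ^ c] for
    [xi < v]. *)
Definition exp_coef (xi c : R) m := (-1) ^+ m * rbin c m * xi `^ (c + m%:R).

Variables (alpha xi c : R).
Hypotheses (alpha0 : 0 < alpha) (xi01 : 0 < xi < 1) (c0 : 0 <= c).

Let a m := alpha * (c + m%:R).

Let a0 m : 0 <= a m.
Proof. by rewrite mulr_ge0 ?(ltW alpha0)// addr_ge0. Qed.

(** Below this [u], [xi] is less than the power [alpha] of [1 - u], so the expansion in [xi / v]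
    converges. *)
Definition exp_radius := 1 - xi `^ (alpha^-1).

Lemma exp_radius_gt0 : 0 < exp_radius.
Proof.
case/andP: xi01 => x0 x1; rewrite subr_gt0.
have := @gt0_ltr_powR R alpha^-1; rewrite invr_gt0 => /(_ alpha0 xi 1).
by rewrite !nnegrE (ltW x0) ler01 powR1 => /(_ isT isT x1).
Qed.

(** For [v] the power [alpha] of [1 - u] and [y = xi / v < 1], two binomial series are composed: in
    [u] for fixed [m], then in [- y] over [m]. Taking absolute values only replaces [- y] by [y], so
    the sums may be exchanged. *)
Lemma genfun_double_series (u : R) : 0 < u < exp_radius ->
  exists2 B : nat -> R,
    (forall k, series (fun m => exp_coef xi c m * rbin (a m) k * u ^+ k) @ \oo
      --> B k) &
    series B @ \oo --> xi `^ c * (xi + (1 - u) `^ alpha) `^ (- c).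
Proof.
case/andP: (xi01) => x0 x1 /andP[u0 ur].
have w0 : xi `^ alpha^-1 < 1 - u by move: ur; rewrite /exp_radius; lra.
have wp : 0 < 1 - u by apply: le_lt_trans w0; exact: powR_ge0.
have u1 : `|u| < 1 by rewrite ger0_norm ?(ltW u0)//; lra.
pose v := (1 - u) `^ alpha.
have v0 : 0 < v by rewrite powR_gt0.
have xv : xi < v.
  have := @gt0_ltr_powR R alpha alpha0 _ _ _ _ w0.
  rewrite -powRrM mulVf ?gt_eqF// powRr1 ?(ltW x0)//; apply.
    by rewrite nnegrE powR_ge0.
  by rewrite nnegrE ltW.
pose y := xi / v.
have y0 : 0 < y by rewrite divr_gt0.
have y1 : y < 1 by rewrite ltr_pdivrMr// mul1r.
have coE m : xi `^ (c + m%:R) * (1 - u) `^ (- a m) = y `^ c * y ^+ m.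
  rewrite -powR_mulrn ?(ltW y0)// -powRD; last by rewrite (gt_eqF y0) implybT.
  by rewrite /a -mulrN powRrM -/v /y powRM ?(ltW x0) ?invr_ge0 ?(ltW v0)//
    powRV// ltW.
have bs m := binomial_series (a0 m) u1.
have [||||B BB BT] := @series_interchange R
  (fun m k => exp_coef xi c m * (rbin (a m) k * u ^+ k))
  (fun m => `|exp_coef xi c m| * (1 - u) `^ (- a m))
  (fun m => exp_coef xi c m * (1 - u) `^ (- a m))
  (y `^ c * (1 - y) `^ (- c)) (y `^ c * (1 - - y) `^ (- c)).
- move=> m; apply: eq_cvg_series (cvg_series_scale _ (bs m)) => k.
  by rewrite /= (normrM (exp_coef xi c m)) (ger0_norm (mulr_ge0 (rbin_ge0 k (a0
    m)) (exprn_ge0 k (ltW u0)))).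
- have y1' : `|y| < 1 by rewrite ger0_norm ?(ltW y0).
  have H := cvg_series_scale (y `^ c) (binomial_series c0 y1').
  apply: eq_cvg_series H => m.
  rewrite /exp_coef -mulrA normrM normrX normrN1 expr1n mul1r ger0_norm.
    by rewrite -(mulrA (rbin c m)) coE; ring.
  by rewrite mulr_ge0 ?rbin_ge0 ?powR_ge0.
- by move=> m; exact: cvg_series_scale (bs m).
- have y1' : `|- y| < 1 by rewrite normrN ger0_norm ?(ltW y0).
  apply: eq_cvg_series (cvg_series_scale (y `^ c) (binomial_series c0 y1')) => m.
  by rewrite /exp_coef -(mulrA _ (xi `^ _)) coE (exprNn y); ring.
exists B.
  by move=> k; apply: eq_cvg_series (BB k) => m; rewrite mulrA.
suff -> : xi `^ c * (xi + (1 - u) `^ alpha) `^ (- c) = y `^ c * (1 - - y) `^ (-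
  c) by [].
rewrite opprK -/v (_ : xi + v = v * (1 + y)); last by rewrite /y; field;
  rewrite gt_eqF.
rewrite powRM ?addr_ge0 ?(ltW y0) ?(ltW v0)// mulrA; congr *%R.
by rewrite /y powRM ?(ltW x0) ?invr_ge0 ?(ltW v0)// powRV// ltW.
Qed.

Definition genfun_coef k := limn (series (fun m => exp_coef xi c m * rbin (a m) k)).

Lemma genfun_coef_cvg_uniq (u : R) (B : nat -> R) k : 0 < u ->
  series (fun m => exp_coef xi c m * rbin (a m) k * u ^+ k) @ \oo --> B k ->
  series (fun m => exp_coef xi c m * rbin (a m) k) @ \oo --> B k / u ^+ k.
Proof.
move=> u0 H; rewrite mulrC; apply: eq_cvg_series (cvg_series_scale (u ^+ k)^-1
  H) => m.
by rewrite mulrC mulfK// gt_eqF// exprn_gt0.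
Qed.

(** The series does not involve [u]: its convergence is read off at one admissible [u] after
    division by [u ^+ k]. *)
Lemma cvg_genfun_coef k :
  series (fun m => exp_coef xi c m * rbin (a m) k) @ \oo --> genfun_coef k.
Proof.
have r0 := exp_radius_gt0.
have uu : 0 < exp_radius / 2 < exp_radius by rewrite divr_gt0//=; lra.
have [B BB _] := genfun_double_series uu.
case/andP: uu => u0 _.
by have H := genfun_coef_cvg_uniq u0 (BB k); rewrite /genfun_coef (cvg_lim _ H).
Qed.

Lemma cvg_genfun_coef_sum N :
  series (fun m => exp_coef xi c m * rbin (a m + 1) N) @ \oo --> series
    genfun_coef N.+1.
Proof.
have -> : series genfun_coef N.+1 = \sum_(k < N.+1) genfun_coef k by rewrite
  seriesEord.
apply: eq_cvg_series (@cvg_series_fsum _ _ N.+1 cvg_genfun_coef) => m.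
by rewrite -mulr_sumr rbin_sum.
Qed.

Lemma cvg_genfun (u : R) : 0 < u < exp_radius ->
  series (fun k => genfun_coef k * u ^+ k) @ \oo -->
  xi `^ c * (xi + (1 - u) `^ alpha) `^ (- c).
Proof.
move=> uu; have [B BB BT] := genfun_double_series uu.
case/andP: uu => u0 _.
apply: eq_cvg_series BT => k; have H := genfun_coef_cvg_uniq u0 (BB k).
by rewrite /genfun_coef (cvg_lim _ H)// divfK// gt_eqF// exprn_gt0.
Qed.

End expansion.

(** * Series for the distribution function of the PDTP arrival times *)

Section pdtp_cdf.
Context (R : realType) d (T : measurableType d) (P : probability T R).
Variables (Z : nat -> {RV P >-> nat}) (alpha nu xi : R).
Hypotheses (pdtpZ : is_PDTP alpha nu xi Z) (alpha0 : 0 < alpha) (nu0 : 0 < nu).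
Hypothesis xi01 : 0 < xi < 1.

(** The generating function of the [n]-th arrival carries a factor [u ^+ n], which shifts its
    coefficients by [n]; hence the argument [N + n] on one side and [N] on the other. *)
Lemma pdtp_cdf_series n N :
  series (fun m => exp_coef xi (n%:R * nu) m *
    rbin (alpha * (n%:R * nu + m%:R) + 1) N) @ \oo -->
  fine (P [set w | (arrival Z n w <= N + n)%N]).
Proof.
have c0 : 0 <= n%:R * nu by rewrite mulr_ge0// ltW.
have xi0 : 0 < xi by case/andP: xi01.
have r0 := exp_radius_gt0 alpha0 xi01.
rewrite (prob_arrival_le (pdtp_indep pdtpZ) (pdtp_ident pdtpZ)).
pose b := genfun_coef alpha xi (n%:R * nu).
(* Both sequences have the same generating function on the interval where the expansion is valid. *)
have bE : conv_pow (step_pmf Z) n =1 (fun k => if (n <= k)%N then b (k - n)%N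
  else 0).
  apply: (power_series_inj r0 (h := fun u =>
    (xi `^ nu * u / (xi + (1 - u) `^ alpha) `^ nu) ^+ n)) => u /andP[u0 ur].
    apply: conv_pow_genfun; [exact: step_pmf_ge0|exact: ltW|].
    apply: pdtp_step_genfun => //; rewrite (ltW u0)/= (lt_le_trans ur)//.
    by rewrite lerBlDr lerDl powR_ge0.
  have uu : 0 < u < exp_radius alpha xi by rewrite u0.
  have u1 : 0 < 1 - u.
    by rewrite subr_gt0 (lt_le_trans ur)// lerBlDr lerDl powR_ge0.
  have v0 : 0 < xi + (1 - u) `^ alpha by rewrite addr_gt0 ?powR_gt0.
  have -> : (xi `^ nu * u / (xi + (1 - u) `^ alpha) `^ nu) ^+ n =
     u ^+ n * (xi `^ (n%:R * nu) * (xi + (1 - u) `^ alpha) `^ (- (n%:R * nu))).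
    have E (x : R) : (x `^ nu) ^+ n = x `^ (n%:R * nu).
      by rewrite -powR_mulrn ?powR_ge0// -powRrM mulrC.
    by rewrite !exprMn exprVn !E powRN; ring.
  have H := cvg_genfun alpha0 xi01 c0 uu.
  apply: eq_cvg_series (cvg_series_shift n (cvg_series_scale (u ^+ n) H)) => k /=.
  case: ifPn => nk; last by rewrite mul0r.
  by rewrite mulrCA -exprD subnKC.
have -> : \sum_(k < (N + n).+1) conv_pow (step_pmf Z) n k = series b N.+1.
  rewrite -(series_shift b n) addSn seriesEord.
  by apply: eq_bigr => i _; exact: bE.
exact: cvg_genfun_coef_sum.
Qed.

End pdtp_cdf.

(** * The limit *)

Section limit.
Context {R : realType}.
Variables (alpha xi0 t : R).
Hypotheses (alpha0 : 0 < alpha) (xi00 : 0 < xi0) (t0 : 0 < t).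

(** The parameter [xi0 * h ^ alpha] for [h = t / M], which turns the limit in [h] into one over
    natural numbers. *)
Definition scaled_xi (M : nat) := xi0 * (t / M%:R) `^ alpha.

Lemma scaled_xi_in01 : \forall M \near \oo, 0 < scaled_xi M < 1.
Proof.
(* The step size [h] at which [xi0 * h ^ alpha = 1]; once [t / M] is below it, the parameter is
   below 1. *)
pose r := xi0^-1 `^ alpha^-1.
have r0 : 0 < r by rewrite powR_gt0// invr_gt0.
near=> M.
have M1 : t / r < M%:R by near: M; exact: nbhs_infty_gtr.
have M0 : 0 < M%:R :> R by apply: lt_trans M1; rewrite divr_gt0.
rewrite mulr_gt0 ?powR_gt0 ?divr_gt0//=.
rewrite -ltr_pdivlMl// mulr1.
have -> : xi0^-1 = r `^ alpha by rewrite /r -powRrM mulVf ?gt_eqF// powRr1//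
  invr_ge0 ltW.
apply: gt0_ltr_powR; rewrite ?nnegrE ?(ltW r0) ?divr_ge0 ?(ltW t0)//.
by rewrite ltr_pdivrMr// mulrC -ltr_pdivrMr.
Unshelve. all: by end_near. Qed.

Variables (c : R) (n : nat).
Hypothesis c0 : 0 <= c.

Let a m := alpha * (c + m%:R).

Let a0 m : 0 <= a m.
Proof. by rewrite mulr_ge0 ?(ltW alpha0)// addr_ge0. Qed.

Definition cdf_term N m := exp_coef (scaled_xi (N + n)) c m * rbin (a m + 1) N.

Definition limit_term m := (-1) ^+ m * rbin c m * (xi0 * t `^ alpha) `^ (c + m%:R) /
  Gamma (a m + 1).

(** After the powers of [t] and [xi0] are factored out, Gauss's limit remains, times a power of
    [(N + n) / N], which tends to 1. *)
Lemma cvg_cdf_term m : cdf_term N m @[N --> \oo] --> limit_term m.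
Proof.
rewrite -cvg_shiftS /=.
rewrite (_ : (fun N => _) = (fun N =>
    (-1) ^+ m * rbin c m * (xi0 * t `^ alpha) `^ (c + m%:R) *
    (rbin (a m + 1) N.+1 / N.+1%:R `^ a m *
     ((N.+1%:R + n%:R) / N.+1%:R) `^ (- a m)))); last first.
  apply/funext => N.
  have N0 : 0 < N.+1%:R :> R by [].
  have M0 : 0 < N.+1%:R + n%:R :> R by rewrite ltr_wpDr.
  rewrite /cdf_term /exp_coef /scaled_xi natrD.
  rewrite [(_ / N.+1%:R) `^ _]powRM ?(ltW M0) ?invr_ge0// powRV// opprK.
  rewrite [(t / _) `^ _]powRM ?(ltW t0) ?invr_ge0 ?(ltW M0)// powRV ?(ltW M0)//.
  rewrite mulrA powRM ?mulr_ge0 ?powR_ge0 ?(ltW xi00)// -(powRrM _ (- alpha))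
    mulNr -/(a m).
  have : N.+1%:R `^ a m != 0 :> R by rewrite gt_eqF ?powR_gt0.
  move: (N.+1%:R `^ a m) => p p0.
  by move: (rbin c m) (rbin (a m + 1) N.+1) => b1 b2; field.
apply: cvgM; first exact: cvg_cst.
rewrite -[X in _ --> X]mulr1; apply: cvgM.
  have H := pochhammer_Gamma_cvg (a0 m).
  by rewrite -(cvg_shiftS (fun N => rbin (a m + 1) N / N%:R `^ a m)) in H * => //.
have P1 : (1 : R) `^ (- a m) = 1 by rewrite powR1.
rewrite -[X in _ --> X]P1.
exact: (cvg_comp _ _ (@cvg_ratio1 R n%:R) (@continuous_powR_gt0 R (- a m) 1 ltr01)).
Qed.

(* The [K] for which [xi0 * (2 * t / K) `^ alpha = 1 / 2]. *)
Definition bound_scale := 2 * t * (2 * xi0) `^ alpha^-1.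

(** Apply [rbin_le_powR] at [u = expR (- y)] with [y = K / M]: the factor [u ^- N] is at most
    [expR K], and [1 - u] is at least [y / 2]. The choice of [K] then leaves exactly the power
    [c + m] of 1/2. *)
Lemma cdf_term_le : \forall N \near \oo, forall m, `|cdf_term N m| <=
  expR bound_scale * 2^-1 `^ c * (rbin c m * 2^-1 ^+ m).
Proof.
have K0 : 0 < bound_scale by rewrite /bound_scale mulr_gt0 ?powR_gt0 ?mulr_gt0.
set K := bound_scale in K0 *.
near=> N => m.
have NK : K < N%:R by near: N; exact: nbhs_infty_gtr.
have N0 : 0 < N%:R :> R by apply: lt_trans NK.
pose M : R := (N + n)%:R.
have NM : N%:R <= M by rewrite ler_nat leq_addr.
have M0 : 0 < M by apply: lt_le_trans NM.
pose y := K / M.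
have y0 : 0 < y by rewrite divr_gt0.
have y20 : 0 <= y / 2 by rewrite divr_ge0// ltW.
have y1 : y <= 1 by rewrite ler_pdivrMr// mul1r (le_trans (ltW NK)).
have u01 : 0 < expR (- y) < 1 by rewrite expR_gt0 expR_lt1 oppr_lt0.
(* For [0 < y <= 1], [expR (- y) <= 1 / (1 + y) <= 1 - y / 2]. *)
have uy : y / 2 <= 1 - expR (- y).
  have : expR (- y) <= (1 + y)^-1.
    by rewrite expRN lef_pV2 ?posrE ?expR_gt0 ?expR_ge1Dx//; lra.
  have : (1 + y)^-1 <= 1 - y / 2.
    rewrite -[leLHS]mul1r ler_pdivrMr; last by lra.
    by nra.
  by lra.
have uN : expR (- y) ^- N <= expR K.
  rewrite -expRM_natl -expRN mulrN opprK ler_expR /y mulrCA ler_piMr ?(ltW K0)//.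
  by rewrite ler_pdivrMr// mul1r.
have rb : rbin (a m + 1) N <= expR K * (y / 2) `^ (- a m).
  apply: (le_trans (rbin_le_powR N (a0 m) u01)).
  apply: ler_pM; rewrite ?invr_ge0 ?exprn_ge0 ?expR_ge0 ?powR_ge0//.
  rewrite !powRN lef_pV2 ?posrE ?powR_gt0 ?divr_gt0//;
    last by apply: lt_le_trans uy; rewrite divr_gt0.
  have z0 : 0 <= 1 - expR (- y) by apply: le_trans uy; rewrite divr_ge0// ltW.
  exact: ge0_ler_powR.
have -> : cdf_term N m = (-1) ^+ m *
    (rbin c m * (scaled_xi (N + n) `^ (c + m%:R) * rbin (a m + 1) N)).
  by rewrite /cdf_term /exp_coef; ring.
rewrite (normrM ((-1) ^+ m)) normrX normrN1 expr1n mul1r.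
have b0 := rbin_ge0 m c0.
have b1 : 0 <= rbin (a m + 1) N by rewrite rbin_ge0// addr_ge0.
rewrite ger0_norm; last exact: (mulr_ge0 b0 (mulr_ge0 (powR_ge0 _ _) b1)).
have -> : expR K * 2^-1 `^ c * (rbin c m * 2^-1 ^+ m) =
   rbin c m * (2^-1 `^ (c + m%:R) * expR K).
  by rewrite powRD ?powR_mulrn ?invr_ge0 ?invr_eq0 ?pnatr_eq0 ?implybT//; ring.
rewrite ler_wpM2l//.
apply: (le_trans (ler_wpM2l (powR_ge0 _ _) rb)).
rewrite [expR K * _]mulrC mulrA ler_wpM2r ?expR_ge0//.
rewrite le_eqVlt; apply/orP; left; apply/eqP.
have -> : (y / 2) `^ (- a m) = ((y / 2) `^ (- alpha)) `^ (c + m%:R).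
  by rewrite -powRrM mulNr.
rewrite -powRM ?powR_ge0 ?mulr_ge0 ?(ltW xi00) ?powR_ge0//; congr (_ `^ _).
(* Since [y] is proportional to [1 / M], so is [t / M] to [y], and [M] cancels from the product. *)
have yE : t / M = (2 * xi0) `^ (- alpha^-1) * (y / 2).
  rewrite /y /K /bound_scale powRN; field.
  by rewrite -natrD (gt_eqF M0) gt_eqF// powR_gt0// mulr_gt0.
rewrite /scaled_xi -/M yE powRM ?powR_ge0//.
rewrite -powRrM mulNr mulVf ?gt_eqF// powR_inv1 ?mulr_ge0 ?(ltW xi00)//.
rewrite powRN; field.
by rewrite (gt_eqF xi00) gt_eqF// powR_gt0// divr_gt0.
Unshelve. all: by end_near. Qed.

(** Tannery's theorem, with the binomial series at 1/2 as dominating series; the limit terms are the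
    Prabhakar terms times the power [c] of [x]. *)
Lemma cvg_cdf_limit (F : nat -> R) :
  (\forall N \near \oo, series (cdf_term N) @ \oo --> F N) ->
  F N @[N --> \oo] --> (xi0 * t `^ alpha) `^ c *
    prabhakar alpha (alpha * c + 1) c (- (xi0 * t `^ alpha)).
Proof.
move=> HF; set x := xi0 * t `^ alpha.
have x0 : 0 < x by rewrite mulr_gt0 ?powR_gt0.
have h1 : `|2^-1 : R| < 1 by rewrite ger0_norm ?invr_ge0//; lra.
have cg : cvgn (series (fun m => expR bound_scale * 2^-1 `^ c * (rbin c m *
  2^-1 ^+ m))).
  by apply/cvg_ex; eexists; apply: cvg_series_scale; exact: binomial_series.
have [cL FL] := tannery cg cdf_term_le cvg_cdf_term HF.
suff -> : x `^ c * prabhakar alpha (alpha * c + 1) c (- x) = limn (series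
  limit_term) by [].
rewrite /prabhakar; set p := fun m : nat => _.
have pE m : p m = (x `^ c)^-1 * limit_term m.
  have xE : x `^ (c + m%:R) = x `^ c * x ^+ m.
    by rewrite powRD ?powR_mulrn ?(ltW x0)// (gt_eqF x0) implybT.
  rewrite /p /limit_term -/x xE /rbin (exprNn x).
  rewrite (_ : alpha * m%:R + _ = a m + 1); last by rewrite /a; ring.
  have : x `^ c != 0 by rewrite gt_eqF ?powR_gt0.
  have := Gamma_gt0 (a0 m); move: (x `^ c) (Gamma _) => y G G0 y0.
  by field; rewrite y0 natr_fact_neq0 gt_eqF.
have H := cvg_series_scale (x `^ c)^-1 cL.
have -> : limn (series p) = (x `^ c)^-1 * limn (series limit_term).
  have pL := eq_cvg_series (fun m => esym (pE m)) H.
  exact: (cvg_lim (@Rhausdorff R) pL).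
by rewrite mulVKf// gt_eqF ?powR_gt0.
Qed.

End limit.

(** * Passage from natural numbers to vanishing step size *)

Lemma cvg_truncn_div (R : realType) (t : R) : 0 < t ->
  Num.truncn (t / h) @[h --> 0^'+] --> \oo.
Proof.
move=> t0; apply/cvgnyPge => A; near=> h.
have h0 : 0 < h by near: h; exact: nbhs_right_gt.
rewrite truncn_ge_nat ?divr_ge0 ?(ltW t0) ?(ltW h0)//.
rewrite ler_pdivlMr// mulrC.
have : h < t / A.+1%:R by near: h; apply: nbhs_right_lt; rewrite divr_gt0.
by rewrite ltr_pdivlMr// -natr1 mulrDr mulr1; lra.
Unshelve. all: by end_near. Qed.

Section main.
Context {R : realType}.
Variables (alpha nu xi0 : R).
Hypotheses (alpha_gt0 : 0 < alpha) (nu_gt0 : 0 < nu) (xi0_gt0 : 0 < xi0).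
Variables (d : R -> measure_display) (T : forall xi : R, measurableType (d xi))
  (P : forall xi : R, probability (T xi) R)
  (Z : forall xi : R, nat -> {RV (P xi) >-> nat}).
Hypothesis Z_pdtp : forall xi : R, 0 < xi -> is_PDTP alpha nu xi (Z xi).
Variables (t : R).
Hypothesis t_gt0 : 0 < t.

Let x := xi0 * t `^ alpha.

Lemma cvg_pdtp_cdf n :
  fine (P (scaled_xi alpha xi0 t M)
    [set w | (arrival (Z (scaled_xi alpha xi0 t M)) n w <= M)%N]) @[M --> \oo] -->
  x `^ (n%:R * nu) * prabhakar alpha (alpha * n%:R * nu + 1) (n%:R * nu) (- x).
Proof.
have c0 : 0 <= n%:R * nu by rewrite mulr_ge0// ltW.
(* The limit is taken along [M = N + n], the form in which the series for the distribution function
   is available. *)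
rewrite -mulrA -(cvg_shiftn n) /=.
apply: (@cvg_cdf_limit _ alpha xi0 t alpha_gt0 xi0_gt0 t_gt0 (n%:R * nu) n c0)
  => //.
have := scaled_xi_in01 alpha_gt0 xi0_gt0 t_gt0.
move=> [K _ HK]; exists K => // N /= KN.
have xi01 := HK (N + n)%N (leq_trans KN (leq_addr _ _)).
case/andP: (xi01) => xi_gt0 _.
exact: (pdtp_cdf_series (Z_pdtp xi_gt0)).
Qed.

Lemma cvg_pdtp_state n :
  state_prob (Z (scaled_xi alpha xi0 t M)) n M @[M --> \oo] -->
  x `^ (n%:R * nu) *
    (prabhakar alpha (alpha * n%:R * nu + 1) (n%:R * nu) (- x) -
     x `^ nu * prabhakar alpha (alpha * n.+1%:R * nu + 1) (n.+1%:R * nu) (- x)).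
Proof.
have x0 : 0 < x by rewrite mulr_gt0 ?powR_gt0.
under eq_fun do rewrite state_probE.
rewrite mulrBr mulrA -powRD; last by rewrite (gt_eqF x0) implybT.
have -> : n%:R * nu + nu = n.+1%:R * nu by rewrite -natr1 mulrDl mul1r.
by apply: cvgB; exact: cvg_pdtp_cdf.
Qed.

End main.

Theorem mainTheorem5 (R : realType) (alpha nu xi0 : R)
    (alpha_gt0 : 0 < alpha) (alpha_le1 : alpha <= 1)
    (nu_gt0 : 0 < nu) (xi0_gt0 : 0 < xi0)
    (d : R -> measure_display) (T : forall xi : R, measurableType (d xi))
    (P : forall xi : R, probability (T xi) R)
    (Z : forall xi : R, nat -> {RV (P xi) >-> nat})
    (Z_pdtp : forall xi : R, 0 < xi -> is_PDTP alpha nu xi (Z xi))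
    (n : nat) (t : R) (t_gt0 : 0 < t) :
  let Phi (k s : nat) (xi : R) : R := state_prob (Z xi) k s in
  Phi n (Num.truncn (t / h)) (xi0 * h `^ alpha)
    @[h --> within [set h | t / h \is a Num.nat] 0^'+] -->
  (xi0 * t `^ alpha) `^ (n%:R * nu) *
    (prabhakar alpha (alpha * n%:R * nu + 1) (n%:R * nu) (- (xi0 * t `^ alpha))
     - (xi0 * t `^ alpha) `^ nu *
       prabhakar alpha (alpha * n.+1%:R * nu + 1) (n.+1%:R * nu)
         (- (xi0 * t `^ alpha))).
Proof.
move=> Phi.
have H : Num.truncn (t / h) @[h --> within [set h | t / h \is a Num.nat] 0^'+]
  --> \oo.
  by apply: cvg_within_filter; exact: cvg_truncn_div.
have C := cvg_comp _ _ H (@cvg_pdtp_state _ _ _ _ alpha_gt0 nu_gt0 xi0_gt0 _ _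
  _ _ Z_pdtp _ t_gt0 n).
apply: cvg_trans C; apply: near_eq_cvg.
rewrite near_withinE; near=> h => /= th.
have h0 : 0 < h by near: h; exact: nbhs_right_gt.
(* As [t / h] is a natural number here, truncation is exact and [h] is recovered as [t / M]. *)
have hE : t / (Num.truncn (t / h))%:R = h.
  by rewrite (truncnK th) invf_div mulrCA divff ?mulr1// gt_eqF.
by rewrite /Phi /scaled_xi hE.
Unshelve. all: by end_near. Qed.
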